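(* In the setting described in the context, there exists a unique Borel probability measure $\mu$ on $\overline{\mathbb{R}}$ satisfying $$\mu=\tfrac13\big((\tau_1)_*\mu+(\tau_2)_*\mu+(\tau_3)_*\mu\big),$$ where $(\tau_i)_*\mu$ is the pushforward under $\tau_i|_{\overline{\mathbb{R}}}\colon\overline{\mathbb{R}}\to\overline{\mathbb{R}}$.
   Context: Let $\mathbb{H}=\{z\in\mathbb{C}:\operatorname{Im}z>0\}$ be the Poincaré upper half-plane (metric $(dx^2+dy^2)/y^2$), $\overline{\mathbb{R}}=\mathbb{R}\cup\{\infty\}$, and $\overline{\mathbb{H}}=\mathbb{H}\cup\overline{\mathbb{R}}$ (a closed disk). A (hyperbolic) line is a set $\{z\in\mathbb{H}:\operatorname{Re}z=x\}$ or $\{z\in\mathbb{H}:|z-x|=r\}$ with $x\in\mathbb{R}$, $r>0$; its reflection $t_L$ is $t_L(z)=2x-\bar z$, resp. $t_L(z)=r^2/(\bar z-x)+x$, extended continuously to $\overline{\mathbb{H}}$. Fix lines $L_1,L_2,L_3\subseteq\mathbb{H}$ and $z_0\in\mathbb{H}$ such that for all distinct $i,i'\in\{1,2,3\}$ either (a) $L_i\cap L_{i'}=\emptyset$ and $z_0$ lies in the connected component of $\mathbb{H}\setminus(L_i\cup L_{i'})$ whose boundary contains both lines, or (b) $L_i,L_{i'}$ meet at an angle of measure $\pi/m(i,i')$ with $m(i,i')\ge2$ an integer, and $z_0$ lies in the interior of that angle. Let $s_i=t_{L_i}$. The one-way reflection $\tau_i\colon\overline{\mathbb{H}}\to\overline{\mathbb{H}}$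 is $\tau_i(z)=s_i(z)$ if $z$ and $z_0$ are on the same side of $L_i$ and $\tau_i(z)=z$ otherwise; it is continuous and maps $\overline{\mathbb{R}}$ to itself. *)

(* Defs.v *)
From HB Require Import structures.
From mathcomp Require Import all_boot all_order all_algebra.
From mathcomp Require Import all_classical all_reals all_analysis.
Set Implicit Arguments. Unset Strict Implicit. Unset Printing Implicit Defensive.
Import Order.TTheory GRing.Theory Num.Theory.
Import numFieldNormedType.Exports.
Local Open Scope classical_set_scope.
Local Open Scope ring_scope.

(* The circle at infinity  \overline{R} = R ∪ {∞} : [Some a] is the real *)
(* point a, [None] is ∞.  Its Borel sigma-algebra (for the topology of  *)
(* the one-point compactification) consists of the sets whose trace on  *)
(* R is Borel.                                                          *)
Definition extR (R : realType) : Type := option R.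

Section extR_measurable.
Variable R : realType.

HB.instance Definition _ := Choice.on (extR R).
HB.instance Definition _ := isPointed.Build (extR R) None.

Definition extR_measurable (A : set (extR R)) : Prop :=
  measurable (@Some R @^-1` A).

Lemma extR_measurable0 : extR_measurable set0.
Proof. by rewrite /extR_measurable preimage_set0; exact: measurable0. Qed.

Lemma extR_measurableC A : extR_measurable A -> extR_measurable (~` A).
Proof. by rewrite /extR_measurable preimage_setC; exact: measurableC. Qed.

Lemma extR_measurable_bigcup (F : (set (extR R))^nat) :
  (forall i, extR_measurable (F i)) -> extR_measurable (\bigcup_i F i).
Proof.
move=> mF; rewrite /extR_measurable preimage_bigcup.
by apply: bigcup_measurable => i _; exact: mF.
Qed.

HB.instance Definition _ := @isMeasurable.Build default_measure_display
  (extR R) extR_measurable extR_measurable0 extR_measurableC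
  extR_measurable_bigcup.

End extR_measurable.

(* Hyperbolic upper half-plane: a point z = a + i b is the pair (a, b). *)
Section hyperbolic.
Variable R : realType.

Definition Hplane : set (R * R) := [set z | 0 < z.2].

(* Lines: [VLine x] = {Re z = x}, [CLine x r] = {|z - x| = r} (r > 0). *)
Inductive hline := VLine of R | CLine of R & R.

Definition wf_hline (L : hline) : Prop :=
  match L with VLine _ => True | CLine _ r => 0 < r end.

(* Defining function of the line: the line is its zero set in H, and   *)
(* its two sides are where it is positive / negative.                  *)
Definition lfun (L : hline) (z : R * R) : R :=
  match L with
  | VLine x => z.1 - x
  | CLine x r => (z.1 - x) ^+ 2 + z.2 ^+ 2 - r ^+ 2
  end.

Definition lineset (L : hline) : set (R * R) :=
  [set z | Hplane z /\ lfun L z = 0].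

(* Euclidean normal vector (gradient of lfun, up to a factor 2) at z.  *)
Definition lgrad (L : hline) (z : R * R) : R * R :=
  match L with
  | VLine _ => (1, 0)
  | CLine x _ => (z.1 - x, z.2)
  end.

Definition dot (u v : R * R) : R := u.1 * v.1 + u.2 * v.2.
Definition enorm (u : R * R) : R := Num.sqrt (dot u u).

(* Unit normal to L at p pointing towards the side of L containing z0. *)
Definition unormal (L : hline) (z0 p : R * R) : R * R :=
  let g := lgrad L p in
  let c := Num.sg (lfun L z0) / enorm g in (c * g.1, c * g.2).

(* The (Euclidean = hyperbolic, by conformality) measure of the angle  *)
(* at p, formed by L and L', whose interior contains z0: near p this   *)
(* angle is the wedge {v | n.v > 0, n'.v > 0} with n, n' the unit      *)
(* normals pointing into it, whose opening is acos (- n.n').            *)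
Definition angle_at (L L' : hline) (z0 p : R * R) : R :=
  acos (- dot (unormal L z0 p) (unormal L' z0 p)).

Definition closure_boundary (C : set (R * R)) : set (R * R) :=
  closure C `\` interior C.

Definition pair_condition (L L' : hline) (z0 : R * R) : Prop :=
  (lineset L `&` lineset L' = set0 /\
   let C := connected_component (Hplane `\` (lineset L `|` lineset L')) z0 in
   C z0 /\ lineset L `<=` closure_boundary C /\
   lineset L' `<=` closure_boundary C)
  \/
  (exists m : nat, (2 <= m)%N /\
   lfun L z0 != 0 /\ lfun L' z0 != 0 /\
   exists p, lineset L p /\ lineset L' p /\
     angle_at L L' z0 p = pi / m%:R).

Definition reflR (L : hline) (z : extR R) : extR R :=
  match L with
  | VLine x => match z with Some a => Some (2 * x - a) | None => None end
  | CLine x r =>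
      match z with
      | Some a => if a == x then None else Some (r ^+ 2 / (a - x) + x)
      | None => Some x
      end
  end.

(* The defining function of L extended to the boundary points of H:   *)
(* at a real point a it is lfun L (a, 0); at ∞ it is 0 for a vertical *)
(* line (∞ lies on its closure) and 1 for a half-circle (∞ is outside). *)
Definition lfun_bd (L : hline) (z : extR R) : R :=
  match z with
  | Some a => lfun L (a, 0)
  | None => match L with VLine _ => 0 | CLine _ _ => 1 end
  end.

(* One-way reflection tau_L restricted to \overline{R}: reflect iff z  *)
(* and z0 lie (strictly) on the same side of L; points on the closure  *)
(* of L are fixed by t_L anyway.                                        *)
Definition oneway (L : hline) (z0 : R * R) (z : extR R) : extR R :=
  if 0 < lfun_bd L z * lfun L z0 then reflR L z else z.

End hyperbolic.

(* Main.v *)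
Require Import Defs.
From HB Require Import structures.
From mathcomp Require Import all_boot all_order all_algebra.
From mathcomp Require Import all_classical all_reals all_analysis.
From mathcomp Require Import measurable_realfun ring lra.
Import Order.TTheory GRing.Theory Num.Theory.
Import numFieldNormedType.Exports.
Local Open Scope classical_set_scope.
Local Open Scope ring_scope.

Set Implicit Arguments.
Unset Strict Implicit.
Unset Printing Implicit Defensive.

(* In the hyperboloid model a boundary point is a ray of the light cone of a
   form B of signature (2,1), and the line L_i is the orthogonal of a unit
   vector a_i with B(a_i, z0) > 0; up to a positive factor, the one-way
   reflection is x |-> x - 2 max(0, B(x, a_i)) a_i.  The chord distance of the
   circle seen from z0 is d(x, y)^2 = - 2 B(x, y) / (h(x) h(y)), where
   h(x) = - B(x, z0).  A one-way reflection never increases |B(x, y)| and never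
   decreases the heights h, so it is 1-Lipschitz, and it contracts strictly as
   soon as h(x) grows by a definite factor.

   The pair conditions give B(a_i, a_j) <= 0 for i <> j.  A Gram determinant
   argument then produces a timelike vector v = sum c_i a_i with c_i >= 0; since
   B(x, v) is bounded below by a positive multiple of h(x) on the light cone,
   for every boundary point x some i has B(x, a_i) >= e h(x).  Hence the three
   maps are contracting on average:
   sum_i d(tau_i x, tau_i y) <= 3 rho d(x, y) with rho < 1.

   Uniqueness: averaging multiplies the Lipschitz constant of a test function
   by rho, so two stationary measures have the same integrals of Lipschitz
   functions and agree on closed arcs.  Existence: reading the ternary digits
   of a uniform t in [0, 1[ as indices, the backward compositions
   tau_(i_1) ... tau_(i_n) (oo) converge for almost every t, and the law of
   their limit is stationary. *)

(** * Lorentz form, light cone and one-way reflections *)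

Section lorentz_space.
Variable R : realType.
Implicit Types (u v w a : R * R * R) (z : R * R) (x y : extR R) (L : hline R).

(** Polarisation of q^2 - p s, which is minus the determinant of the symmetric matrix with entries
    p, q, q, s. In this model ∂H is the conic of rank-one matrices. *)
Definition lorentz v w : R :=
  v.1.2 * w.1.2 - (v.1.1 * w.2 + v.2 * w.1.1) / 2.

Definition vscale (k : R) v : R * R * R := (k * v.1.1, k * v.1.2, k * v.2).

Definition vadd v w : R * R * R := (v.1.1 + w.1.1, v.1.2 + w.1.2, v.2 + w.2).

Definition point z : R * R * R := (1, z.1, z.1 ^+ 2 + z.2 ^+ 2).

Definition ray x : R * R * R :=
  if x is Some b then (1, b, b ^+ 2) else (0, 0, 1).

Definition height z v : R := - lorentz v (point z).

Definition fold a v : R * R * R :=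
  vadd v (vscale (- (2 * Num.max 0 (lorentz v a))) a).

Lemma lorentzC v w : lorentz v w = lorentz w v.
Proof. by rewrite /lorentz; ring. Qed.

Lemma lorentzZl k v w : lorentz (vscale k v) w = k * lorentz v w.
Proof. by rewrite /lorentz /=; ring. Qed.

Lemma lorentzZr k v w : lorentz v (vscale k w) = k * lorentz v w.
Proof. by rewrite /lorentz /=; ring. Qed.

Lemma lorentzDl u v w : lorentz (vadd u v) w = lorentz u w + lorentz v w.
Proof. by rewrite /lorentz /=; ring. Qed.

Lemma lorentzDr u v w : lorentz u (vadd v w) = lorentz u v + lorentz u w.
Proof. by rewrite /lorentz /=; ring. Qed.

Lemma heightZ z k v : height z (vscale k v) = k * height z v.
Proof. by rewrite /height lorentzZl mulrN. Qed.

(** With s = B(v, a), t = B(w, a) and positive and negative parts s+, s-, t+, t-, the gain is 2 (s+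
    t- + s- t+). Between light rays B is nonpositive, so folding shrinks |B|. *)
Lemma lorentz_fold a v w : lorentz a a = 1 ->
  lorentz v w <= lorentz (fold a v) (fold a w).
Proof.
move=> a1; rewrite /fold !(lorentzDl, lorentzDr, lorentzZl, lorentzZr) a1.
rewrite (lorentzC a w).
by case: (leP 0 (lorentz v a)) => ?; case: (leP 0 (lorentz w a)) => ?; nra.
Qed.

Lemma height_fold z a v : height z (fold a v) =
  height z v + 2 * lorentz a (point z) * Num.max 0 (lorentz v a).
Proof. by rewrite /height /fold lorentzDl lorentzZl; ring. Qed.

Lemma height_fold_ge z a v : 0 <= lorentz a (point z) ->
  height z v <= height z (fold a v).
Proof.
move=> a0; rewrite height_fold lerDl mulr_ge0 ?mulr_ge0//.
by rewrite le_max lexx.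
Qed.

Lemma lorentz_ray x : lorentz (ray x) (ray x) = 0.
Proof. by case: x => [b|]; rewrite /lorentz /=; field. Qed.

Lemma height_ray_gt0 z x : 0 < z.2 -> 0 < height z (ray x).
Proof.
rewrite /height /lorentz; case: x => [b|] /= z0; last by lra.
have ? := sqr_ge0 (b - z.1).
by nra.
Qed.

(* Euclidean coordinates on the slice [height z v = 1], in which the light cone
   cuts out a circle. *)
Definition horo1 z v : R := (v.1.2 - z.1 * v.1.1) / height z v.

Definition horo2 z v : R := z.2 * v.1.1 / height z v.

Lemma horo_sqdist z v w : lorentz v v = 0 -> lorentz w w = 0 ->
  height z v != 0 -> height z w != 0 ->
  (horo1 z v - horo1 z w) ^+ 2 + (horo2 z v - horo2 z w) ^+ 2 =
  - (2 * lorentz v w) / (height z v * height z w).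
Proof.
rewrite /horo1 /horo2.
case: v => [[p q] s]; case: w => [[p' q'] s'].
set h := height z _; set h' := height z (p', _, _).
rewrite /lorentz /= => v0 w0 hn0 h'n0.
(* The height replaces the last coordinate as a free variable. *)
have sE : s = 2 * h + 2 * z.1 * q - (z.1 ^+ 2 + z.2 ^+ 2) * p.
  by rewrite /h /height /lorentz /=; field.
have sE' : s' = 2 * h' + 2 * z.1 * q' - (z.1 ^+ 2 + z.2 ^+ 2) * p'.
  by rewrite /h' /height /lorentz /=; field.
clearbody h h'; subst s s'.
(* Isotropy: in the slice the squared norm of v is 2 p / h, so only the cross term of the squared
   distance needs expanding. *)
have E : q ^+ 2 + (z.1 ^+ 2 + z.2 ^+ 2) * p ^+ 2 - 2 * z.1 * p * q = 2 * h * p.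
  by lra.
have E' : q' ^+ 2 + (z.1 ^+ 2 + z.2 ^+ 2) * p' ^+ 2 - 2 * z.1 * p' * q' =
    2 * h' * p' by lra.
have -> : ((q - z.1 * p) / h - (q' - z.1 * p') / h') ^+ 2 +
    (z.2 * p / h - z.2 * p' / h') ^+ 2 =
  (q ^+ 2 + (z.1 ^+ 2 + z.2 ^+ 2) * p ^+ 2 - 2 * z.1 * p * q) / h ^+ 2 +
  (q' ^+ 2 + (z.1 ^+ 2 + z.2 ^+ 2) * p' ^+ 2 - 2 * z.1 * p' * q') / h' ^+ 2 -
  2 * (q * q' - z.1 * (p * q' + p' * q) + (z.1 ^+ 2 + z.2 ^+ 2) * p * p') /
    (h * h').
  by field; apply/andP; split.
by rewrite E E'; field; apply/andP; split.
Qed.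

(** Unit spacelike vector orthogonal to the plane that cuts out L, with the sign for which [lfun L]
    is a positive multiple ([lnorm L]) of the pairing with it. [hroot] then reorients it towards
    z. *)
Definition polar L : R * R * R :=
  match L with
  | VLine b => (0, 1, 2 * b)
  | CLine b r => (- r^-1, - (b / r), - ((b ^+ 2 - r ^+ 2) / r))
  end.

Definition lnorm L : R := if L is CLine _ r then 2 * r else 1.

Definition hroot L z : R * R * R := vscale (Num.sg (lfun L z)) (polar L).

Lemma lnorm_gt0 L : wf_hline L -> 0 < lnorm L.
Proof. by case: L => //= b r r0; rewrite mulr_gt0. Qed.

Lemma lfun_polar L z : wf_hline L ->
  lfun L z = lnorm L * lorentz (point z) (polar L).
Proof.
case: L => [b|b r] /= wfL; rewrite /lorentz /=; first by field.
by field; rewrite gt_eqF.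
Qed.

Lemma lfun_bd_polar L x : wf_hline L ->
  lfun_bd L x = lnorm L * lorentz (ray x) (polar L).
Proof.
case: L => [b|b r] /= wfL; case: x => [c|]; rewrite /lorentz /=; try by field.
- by field; rewrite gt_eqF.
- by field; rewrite gt_eqF.
Qed.

Lemma lorentz_polar L : wf_hline L -> lorentz (polar L) (polar L) = 1.
Proof.
by case: L => [b|b r] /= wfL; rewrite /lorentz /=; field; rewrite ?gt_eqF.
Qed.

Lemma lorentz_root L z : wf_hline L -> lfun L z != 0 ->
  lorentz (hroot L z) (hroot L z) = 1.
Proof.
move=> wfL Lz; rewrite lorentzZl lorentzZr lorentz_polar// mulr1.
by rewrite -expr2 sqr_sg Lz.
Qed.

Lemma lorentz_root_point L z : wf_hline L -> lfun L z != 0 ->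
  0 < lorentz (hroot L z) (point z).
Proof.
move=> wfL Lz; rewrite lorentzZl lorentzC -(pmulr_rgt0 _ (lnorm_gt0 wfL)).
by rewrite mulrCA -lfun_polar// -normrEsg normr_gt0.
Qed.

Lemma lorentz_ray_root_gt0 L z x : wf_hline L ->
  (0 < lorentz (ray x) (hroot L z)) = (0 < lfun_bd L x * lfun L z).
Proof.
move=> wfL; rewrite lorentzZr lfun_bd_polar//.
rewrite -mulrA (pmulr_rgt0 _ (lnorm_gt0 wfL)).
have [c0|c0|<-] := ltgtP 0 (lfun L z).
- by rewrite gtr0_sg// mul1r pmulr_lgt0.
- by rewrite ltr0_sg// mulN1r oppr_gt0 nmulr_lgt0.
- by rewrite sgr0 mul0r mulr0.
Qed.

(** On the projectivised light cone the one-way reflection is [fold]; k only renormalises the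
    representative of the image ray. *)
Lemma ray_oneway L z x : wf_hline L -> lfun L z != 0 ->
  exists2 k, 0 < k & ray (oneway L z x) = vscale k (fold (hroot L z) (ray x)).
Proof.
move=> wfL Lz; rewrite /oneway -lorentz_ray_root_gt0//.
case: ifPn => [xL|]; last first.
  rewrite -leNgt => xL; exists 1 => //.
  rewrite /fold max_l// mulr0 oppr0 /vadd /vscale /= !mul0r !addr0 !mul1r.
  by rewrite -!surjective_pairing.
have -> : fold (hroot L z) (ray x) =
    vadd (ray x) (vscale (- (2 * lorentz (ray x) (polar L))) (polar L)).
  rewrite /fold max_r ?ltW// /hroot lorentzZr.
  (* The root enters a reflection quadratically, so its orientation drops out. *)
  have sg2 : Num.sg (lfun L z) * Num.sg (lfun L z) = 1.
    by rewrite -expr2 sqr_sg Lz.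
  set s := Num.sg _ in sg2 *; set l := lorentz _ _.
  rewrite /vadd /vscale /=.
  have E t : - (2 * (s * l)) * (s * t) = - (2 * l) * t.
    by rewrite -[in RHS](mul1r l) -sg2; ring.
  by rewrite !E.
have {}xL : lorentz (ray x) (polar L) != 0.
  by apply: contraTneq xL; rewrite lorentzZr => ->; rewrite mulr0 ltxx.
case: L wfL {Lz} xL => [b|b r] /= wfL xL; last first.
  have r0 : r != 0 by rewrite gt_eqF.
  (* Inversion sends ∞ to b, b to ∞, and other points to real points; k makes the first coordinate
     1, or the last one if the image is ∞. *)
  case: x xL => [c|] /= _; last first.
    exists (r ^+ 2); first by rewrite exprn_gt0.
    by rewrite /vadd /vscale /lorentz /=; congr (_, _, _); field.
  case: ifPn => [/eqP ->|cb].
    exists (r ^- 2); first by rewrite invr_gt0 exprn_gt0.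
    by rewrite /vadd /vscale /lorentz /=; congr (_, _, _); field.
  rewrite -subr_eq0 in cb.
  exists (r ^+ 2 / (c - b) ^+ 2).
    apply: divr_gt0; first by rewrite exprn_gt0.
    by rewrite lt_neqAle sqr_ge0 eq_sym sqrf_eq0 cb.
  by rewrite /vadd /vscale /lorentz /=; congr (_, _, _); field; rewrite ?cb ?r0.
exists 1 => //; case: x xL => [c|] /= xL; last first.
  (* ∞ is an end of every vertical line, so it is never strictly on the side of z. *)
  by move: xL; rewrite /lorentz /= !mul0r mulr0 addr0 mul0r subr0 eqxx.
by rewrite /vadd /vscale /lorentz /=; congr (_, _, _); field.
Qed.

End lorentz_space.

(** * Three roots with nonpositive pairings: a timelike vector in their cone *)

Section nonobtuse_roots.
Variable R : realType.
Implicit Types (u v w a : R * R * R) (z : R * R) (x y : extR R) (L : hline R).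

(* The vanishing Gram determinant of four vectors in dimension three, expanded
   along the fourth one. *)
Lemma lorentz_gram4 a1 a2 a3 w :
  let l := @lorentz R in
  l w w * (l a1 a1 * l a2 a2 * l a3 a3 + 2 * l a1 a2 * l a1 a3 * l a2 a3
           - l a1 a1 * l a2 a3 ^+ 2 - l a2 a2 * l a1 a3 ^+ 2
           - l a3 a3 * l a1 a2 ^+ 2) =
  l a1 w ^+ 2 * (l a2 a2 * l a3 a3 - l a2 a3 ^+ 2) +
  l a2 w ^+ 2 * (l a1 a1 * l a3 a3 - l a1 a3 ^+ 2) +
  l a3 w ^+ 2 * (l a1 a1 * l a2 a2 - l a1 a2 ^+ 2) +
  2 * l a1 w * l a2 w * (l a1 a3 * l a2 a3 - l a1 a2 * l a3 a3) +
  2 * l a1 w * l a3 w * (l a1 a2 * l a2 a3 - l a1 a3 * l a2 a2) +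
  2 * l a2 w * l a3 w * (l a1 a2 * l a1 a3 - l a2 a3 * l a1 a1).
Proof.
rewrite /lorentz /=.
case: a1 => [[p1 q1] s1]; case: a2 => [[p2 q2] s2]; case: a3 => [[p3 q3] s3].
case: w => [[p q] s] /=.
by field.
Qed.

Definition comb3 (c1 c2 c3 : R) a1 a2 a3 :=
  vadd (vscale c1 a1) (vadd (vscale c2 a2) (vscale c3 a3)).

Lemma lorentz_comb3l c1 c2 c3 a1 a2 a3 w :
  lorentz (comb3 c1 c2 c3 a1 a2 a3) w =
  c1 * lorentz a1 w + c2 * lorentz a2 w + c3 * lorentz a3 w.
Proof. by rewrite !(lorentzDl, lorentzZl) addrA. Qed.

(** Apply [lorentz_gram4] with w = [point z], where B(w, w) = - z.2^2. If the determinant were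
    nonnegative, the left side would be nonpositive, while the signs of the pairings make every term
    on the right nonnegative. All terms then vanish, so two of the pairings have square 1, whereas
    the three squares sum to at most 1. *)
Lemma gram_det_lt0 a1 a2 a3 z : 0 < z.2 ->
  lorentz a1 a1 = 1 -> lorentz a2 a2 = 1 -> lorentz a3 a3 = 1 ->
  0 < lorentz a1 (point z) -> 0 < lorentz a2 (point z) ->
  0 < lorentz a3 (point z) ->
  lorentz a1 a2 <= 0 -> lorentz a1 a3 <= 0 -> lorentz a2 a3 <= 0 ->
  1 + 2 * lorentz a1 a2 * lorentz a1 a3 * lorentz a2 a3
    - lorentz a2 a3 ^+ 2 - lorentz a1 a3 ^+ 2 - lorentz a1 a2 ^+ 2 < 0.
Proof.
move=> z0 a11 a22 a33.
have := lorentz_gram4 a1 a2 a3 (point z); rewrite /= a11 a22 a33 !mul1r !mulr1.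
have -> : lorentz (point z) (point z) = - z.2 ^+ 2.
  by rewrite /lorentz /=; field.
move: (lorentz a1 a2) (lorentz a1 a3) (lorentz a2 a3) => x y w.
move: (lorentz a1 _) (lorentz a2 _) (lorentz a3 _) => g1 g2 g3.
move=> E g10 g20 g30 x0 y0 w0; rewrite ltNge; apply/negP => D0.
have xy0 : 0 <= x * y by nra.
have xw0 : 0 <= x * w by nra.
have yw0 : 0 <= y * w by nra.
have xyw0 : x * y * w <= 0 by nra.
have x2 := sqr_ge0 x; have y2 := sqr_ge0 y; have w2 := sqr_ge0 w.
have x1 : 0 <= 1 - x ^+ 2 by lra.
have y1 : 0 <= 1 - y ^+ 2 by lra.
have w1 : 0 <= 1 - w ^+ 2 by lra.
have g1w : 0 <= g1 ^+ 2 * (1 - w ^+ 2) by rewrite mulr_ge0 ?sqr_ge0.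
have g2y : 0 <= g2 ^+ 2 * (1 - y ^+ 2) by rewrite mulr_ge0 ?sqr_ge0.
have g3x : 0 <= g3 ^+ 2 * (1 - x ^+ 2) by rewrite mulr_ge0 ?sqr_ge0.
have g12 : 0 <= 2 * g1 * g2 * (y * w - x).
  by apply: mulr_ge0; [rewrite !mulr_ge0// ltW|lra].
have g13 : 0 <= 2 * g1 * g3 * (x * w - y).
  by apply: mulr_ge0; [rewrite !mulr_ge0// ltW|lra].
have g23 : 0 <= 2 * g2 * g3 * (x * y - w).
  by apply: mulr_ge0; [rewrite !mulr_ge0// ltW|lra].
have zD : 0 <= z.2 ^+ 2 * (1 + 2 * x * y * w - w ^+ 2 - y ^+ 2 - x ^+ 2).
  by rewrite mulr_ge0 ?sqr_ge0.
have w10 : g1 ^+ 2 * (1 - w ^+ 2) = 0 by lra.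
have y10 : g2 ^+ 2 * (1 - y ^+ 2) = 0 by lra.
have /eqP := w10; rewrite mulf_eq0 sqrf_eq0 gt_eqF//= => /eqP.
have /eqP := y10; rewrite mulf_eq0 sqrf_eq0 gt_eqF//= => /eqP.
by lra.
Qed.

Lemma timelike_in_cone a1 a2 a3 z : 0 < z.2 ->
  lorentz a1 a1 = 1 -> lorentz a2 a2 = 1 -> lorentz a3 a3 = 1 ->
  0 < lorentz a1 (point z) -> 0 < lorentz a2 (point z) ->
  0 < lorentz a3 (point z) ->
  lorentz a1 a2 <= 0 -> lorentz a1 a3 <= 0 -> lorentz a2 a3 <= 0 ->
  exists c1 c2 c3, let v := comb3 c1 c2 c3 a1 a2 a3 in
    [/\ 0 <= c1, 0 <= c2, 0 <= c3, lorentz v v < 0 & 0 < lorentz v (point z)].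
Proof.
move=> z0 a11 a22 a33 g1 g2 g3 a12 a13 a23.
have D0 := gram_det_lt0 z0 a11 a22 a33 g1 g2 g3 a12 a13 a23.
have vv c1 c2 c3 : lorentz (comb3 c1 c2 c3 a1 a2 a3) (comb3 c1 c2 c3 a1 a2 a3) =
    c1 ^+ 2 + c2 ^+ 2 + c3 ^+ 2 + 2 * c1 * c2 * lorentz a1 a2 +
    2 * c1 * c3 * lorentz a1 a3 + 2 * c2 * c3 * lorentz a2 a3.
  rewrite !(lorentzDl, lorentzDr, lorentzZl, lorentzZr) a11 a22 a33.
  by rewrite (lorentzC a2 a1) (lorentzC a3 a1) (lorentzC a3 a2); ring.
have [x1|x1|x1] := ltgtP (lorentz a1 a2) (-1).
(* Ultraparallel lines: a1 + a2 has square 2 + 2 B(a1, a2) < 0. *)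
- exists 1, 1, 0 => /=; rewrite vv lorentz_comb3l; split => //; lra.
(* The last row of the adjugate of the Gram matrix, a multiple of the part of a3 orthogonal to a1
   and a2; the square is (1 - B(a1, a2)^2) times the Gram determinant. *)
- exists (lorentz a1 a2 * lorentz a2 a3 - lorentz a1 a3),
    (lorentz a1 a2 * lorentz a1 a3 - lorentz a2 a3),
    (1 - lorentz a1 a2 ^+ 2) => /=.
  rewrite vv lorentz_comb3l.
  move: (lorentz a1 a2) (lorentz a1 a3) (lorentz a2 a3) D0 x1 a12 a13 a23.
  move=> x y w D0 x1 x0 y0 w0.
  have xx : 0 < 1 - x ^+ 2 by nra.
  have xw : 0 <= x * w by nra.
  have xy : 0 <= x * y by nra.
  split; [lra|lra|exact: ltW| |].
  + have := mulr_gt0 xx (_ : 0 < - (1 + 2 * x * y * w - w ^+ 2 - y ^+ 2 - x ^+ 2)).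
    by rewrite oppr_gt0 => /(_ D0); lra.
  + have ? := mulr_gt0 xx g3.
    have ? : 0 <= (x * w - y) * lorentz a1 (point z) by apply: mulr_ge0; [lra|exact: ltW].
    have ? : 0 <= (x * y - w) * lorentz a2 (point z) by apply: mulr_ge0; [lra|exact: ltW].
    lra.
(* Here a1 + a2 is isotropic. With c the third coefficient the square is - c^2, which is the Gram
   determinant and hence nonzero. *)
- exists 1, 1, (- (lorentz a1 a3 + lorentz a2 a3)) => /=.
  rewrite vv lorentz_comb3l x1; rewrite x1 in D0; split => //; nra.
Qed.

(** At a real point c, 2 B(x, v) is the positive definite form - p c^2 + 2 q c - s. Its least
    eigenvalue is at least determinant over trace, D / T, and twice the height is at most M (c^2 +
    1); hence k = D / (T M). *)
Lemma timelike_height_bound v z : 0 < z.2 ->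
  lorentz v v < 0 -> 0 < lorentz v (point z) ->
  exists2 k, 0 < k & forall x, k * height z (ray x) <= lorentz (ray x) v.
Proof.
case: v => [[p q] s]; case: z => [a b] b0; rewrite /lorentz /= in b0 *.
move=> vv vz.
have q2 := sqr_ge0 q.
(* Timelike means p s > q^2, so p and s share a sign; B(v, [point z]) > 0 makes it negative. *)
have p0 : p < 0.
  rewrite ltNge; apply/negP => p0.
  have p1 : 0 < p by rewrite lt_neqAle p0 andbT; apply: contraTneq vv => <-; nra.
  have := sqr_ge0 (p * a - q); have := sqr_ge0 b; nra.
have s0 : s < 0 by nra.
set D := p * s - q ^+ 2; set T := - p - s; set M := 2 + 2 * a ^+ 2 + b ^+ 2.
have D0 : 0 < D by rewrite /D; nra.
have T0 : 0 < T by rewrite /T; lra.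
have M0 : 0 < M by rewrite /M; have := sqr_ge0 a; have := sqr_ge0 b; lra.
have kE : D / (T * M) * M * T = D by field; rewrite !gt_eqF.
have k0 : 0 < D / (T * M) by rewrite divr_gt0// mulr_gt0.
set k := D / (T * M) in kE k0; exists k => // -[c|]; rewrite /height /lorentz /=; last first.
  have pT : D <= - p * T by rewrite /D /T; nra.
  have : k * M <= - p by rewrite -(ler_pM2r T0) kE.
  have M1 : 1 <= M by rewrite /M; have := sqr_ge0 a; have := sqr_ge0 b; lra.
  have := ler_wpM2l (ltW k0) M1; lra.
have H1 : D * (c ^+ 2 + 1) <= (- p * c ^+ 2 + 2 * q * c - s) * T.
  have := sqr_ge0 (p * c - q); have := sqr_ge0 (q * c - s).
  by rewrite /D /T; lra.
have H2 : k * M * (c ^+ 2 + 1) <= - p * c ^+ 2 + 2 * q * c - s.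
  by rewrite -(ler_pM2r T0) mulrAC kE.
have H3 : (c - a) ^+ 2 + b ^+ 2 <= M * (c ^+ 2 + 1).
  have := sqr_ge0 (c + a); have := sqr_ge0 (a * c); have := sqr_ge0 (b * c).
  by have := sqr_ge0 c; rewrite /M; nra.
have := ler_wpM2l (ltW k0) H3; lra.
Qed.

Lemma roots_cover a1 a2 a3 z : 0 < z.2 ->
  lorentz a1 a1 = 1 -> lorentz a2 a2 = 1 -> lorentz a3 a3 = 1 ->
  0 < lorentz a1 (point z) -> 0 < lorentz a2 (point z) ->
  0 < lorentz a3 (point z) ->
  lorentz a1 a2 <= 0 -> lorentz a1 a3 <= 0 -> lorentz a2 a3 <= 0 ->
  exists2 e, 0 < e & forall x, [\/ e * height z (ray x) <= lorentz (ray x) a1,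
    e * height z (ray x) <= lorentz (ray x) a2 |
    e * height z (ray x) <= lorentz (ray x) a3].
Proof.
move=> z0 a11 a22 a33 g1 g2 g3 a12 a13 a23.
have [c1 [c2 [c3 /= [c10 c20 c30 vv vz]]]] :=
  timelike_in_cone z0 a11 a22 a33 g1 g2 g3 a12 a13 a23.
have [k k0 kP] := timelike_height_bound z0 vv vz.
(* The extra 1 keeps the inequality strict: if all three bounds failed, B(x, v) would fall below k
   h(x). *)
have S0 : 0 < c1 + c2 + c3 + 1 by lra.
exists (k / (c1 + c2 + c3 + 1)); first by rewrite divr_gt0.
move=> x; have {kP} := kP x; rewrite lorentzC lorentz_comb3l.
have h0 : 0 < k / (c1 + c2 + c3 + 1) * height z (ray x).
  by rewrite mulr_gt0 ?divr_gt0// height_ray_gt0.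
have -> : k * height z (ray x) =
    (k / (c1 + c2 + c3 + 1) * height z (ray x)) * (c1 + c2 + c3 + 1).
  by field; rewrite gt_eqF.
rewrite !(lorentzC _ (ray x)); set h := _ * height z _ in h0 *.
have [?|B1] := leP h (lorentz (ray x) a1); first by constructor 1.
have [?|B2] := leP h (lorentz (ray x) a2); first by constructor 2.
have [?|B3] := leP h (lorentz (ray x) a3); first by constructor 3.
have := ler_wpM2l c10 (ltW B1); have := ler_wpM2l c20 (ltW B2).
by have := ler_wpM2l c30 (ltW B3); lra.
Qed.

End nonobtuse_roots.

(** * From the pair conditions to nonpositive pairings of roots *)

Section pair_condition.
Variable R : realType.
Implicit Types (z : R * R) (L : hline R).

Lemma lfun_continuous L : continuous (lfun L).
Proof.
have c1 : continuous (fst : R * R -> R) by move=> z; exact: cvg_fst.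
have c2 : continuous (snd : R * R -> R) by move=> z; exact: cvg_snd.
have sq (g : R * R -> R) : continuous g -> continuous (fun z => g z ^+ 2).
  move=> cg z; rewrite (_ : (fun z => g z ^+ 2) = g \* g); last exact/funext.
  by apply: cvgM; exact: cg.
case: L => [b|b r] z /=.
  by apply: cvgB; [exact: c1|exact: cvg_cst].
apply: cvgB; last exact: cvg_cst.
apply: cvgD; last exact: sq.
apply: (sq (fun z => z.1 - b)) => {}z.
by apply: cvgB; [exact: c1|exact: cvg_cst].
Qed.

Lemma connected_lfun_sign L (C : set (R * R)) z p : connected C ->
  (forall q, C q -> lfun L q != 0) -> C z -> C p -> 0 < lfun L p * lfun L z.
Proof.
move=> connC C0 Cz Cp.
have /connected_intervalP itv : connected (lfun L @` C).
  apply: connected_continuous_connected => //.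
  by apply: continuous_subspaceT; exact: lfun_continuous.
have n0 : ~ (lfun L @` C) 0 by move=> [q /C0 /eqP].
have Iz : (lfun L @` C) (lfun L z) by exists z.
have Ip : (lfun L @` C) (lfun L p) by exists p.
have [z0|z0|z0] := ltgtP (lfun L z) 0; last 1 first.
- by rewrite z0 in Iz.
- rewrite nmulr_lgt0// ltNge; apply/negP => p0.
  by apply: n0; apply: (itv _ _ Iz Ip); rewrite (ltW z0).
- rewrite pmulr_lgt0// ltNge; apply/negP => p0.
  by apply: n0; apply: (itv _ _ Ip Iz); rewrite (ltW z0) andbT.
Qed.

(** By connectedness [lfun L] keeps the sign it has at z on C, hence weakly on the closure of C,
    which contains L'; disjointness from L makes the sign strict. *)
Lemma lineset_facing L L' z :
  let C := connected_component (Hplane (R := R) `\` (lineset L `|` lineset L')) z in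
  lineset L `&` lineset L' = set0 -> C z ->
  lineset L' `<=` closure_boundary C ->
  forall p, lineset L' p -> 0 < lfun L p * lfun L z.
Proof.
move=> C LL' Cz L'C p L'p.
have C0 q : C q -> lfun L q != 0.
  move=> /connected_component_sub [Hq nq]; apply/eqP => Lq0.
  by apply: nq; left.
have CE : C `<=` [set q | 0 <= lfun L q * lfun L z].
  by move=> q Cq; apply/ltW/(@connected_lfun_sign L C) => //; exact: component_connected.
have cl : closed [set q | 0 <= lfun L q * lfun L z].
  have -> : [set q | 0 <= lfun L q * lfun L z] =
      (fun q => lfun L q * lfun L z) @^-1` [set t | 0 <= t] by [].
  apply: preimage_closed; last exact: closed_ge.
  move=> q _; apply: cvgM; last exact: cvg_cst.
  exact: lfun_continuous.
have [/(closure_subset CE) + _] := L'C p L'p.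
rewrite -(closure_id _).1// /= le_eqVlt => /predU1P[/esym /eqP|//].
rewrite mulf_eq0 (negbTE (C0 _ Cz)) orbF => /eqP Lp.
have : (lineset L `&` lineset L') p by split=> //; split=> //; case: L'p.
by rewrite LL'.
Qed.

Lemma lorentz_root_le0 L L' z :
  lfun L z * lfun L' z * lorentz (polar L) (polar L') <= 0 ->
  lorentz (hroot L z) (hroot L' z) <= 0.
Proof.
rewrite lorentzZl lorentzZr -sgr_le0 !sgrM => h.
by rewrite -sgr_le0 !sgrM !sgr_id mulrA.
Qed.

(** The facing conditions are mostly needed only at the tops of half-circles and at height 1 on
    vertical lines. Two half-circles with z outside both also require their would-be intersection
    point. *)
Lemma disjoint_roots L L' z : wf_hline L -> wf_hline L' ->
  (forall p, lineset L' p -> 0 < lfun L p * lfun L z) ->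
  (forall p, lineset L p -> 0 < lfun L' p * lfun L' z) ->
  lorentz (hroot L z) (hroot L' z) <= 0.
Proof.
wlog : L L' / if L' is VLine _ then if L is VLine _ then true else false else true.
  move=> wl; case: L => [b|b r]; case: L' => [b'|b' r'] *; try exact: wl.
  by rewrite lorentzC; exact: wl.
case: L L' => [b|b r] [b'|b' r'] // _ wfL wfL' HL HL'; apply: lorentz_root_le0.
- have := HL (b', 1); have := HL' (b, 1); rewrite /lorentz /lineset /Hplane /=.
  move=> /(_ (conj ltr01 (subrr _))) h1 /(_ (conj ltr01 (subrr _))) h2.
  by have := mulr_gt0 h1 h2; have := sqr_ge0 (b - b'); nra.
- have := HL (b', r'); have := HL' (b, r'); rewrite /lorentz /lineset /Hplane /=.
  rewrite subrr => /(_ (conj wfL' erefl)) h1.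
  have h : (b' - b' : R) ^+ 2 + r' ^+ 2 - r' ^+ 2 = 0 by ring.
  move=> /(_ (conj wfL' h)) h2.
  set f := z.1 - b in h2 *; set f' := (z.1 - b') ^+ 2 + z.2 ^+ 2 - r' ^+ 2 in h1 *.
  have f'0 : 0 < f'.
    by move: h1; rewrite addrK => h1; have := sqr_ge0 (b - b'); nra.
  have -> : f * f' * (1 * - (b' / r') - (0 * - ((b' ^+ 2 - r' ^+ 2) / r') +
      2 * b * - r'^-1) / 2) = - (f' * ((b' - b) * f) / r').
    by field; rewrite gt_eqF.
  rewrite oppr_le0; apply: divr_ge0; last exact: ltW.
  by apply: mulr_ge0; exact: ltW.
- rewrite /= in wfL wfL'.
  have [r0 r'0] : r != 0 /\ r' != 0 by rewrite !gt_eqF.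
  have := HL (b', r'); have := HL' (b, r); rewrite /lorentz /lineset /Hplane /=.
  have h t s : (t - t : R) ^+ 2 + s ^+ 2 - s ^+ 2 = 0 by ring.
  move=> /(_ (conj wfL (h _ _))) h1 /(_ (conj wfL' (h _ _))) h2.
  have := HL _; rewrite /lineset /Hplane /= => {}HL.
  set f := (z.1 - b) ^+ 2 + z.2 ^+ 2 - r ^+ 2 in h2 HL *.
  set f' := (z.1 - b') ^+ 2 + z.2 ^+ 2 - r' ^+ 2 in h1 *.
  set l := - (b / r) * _ - _.
  have -> : l = (r ^+ 2 + r' ^+ 2 - (b - b') ^+ 2) / (2 * r * r').
    by rewrite /l; field; rewrite r'0 r0.
  have rr : 0 < 2 * r * r' by rewrite !mulr_gt0.
  rewrite mulrA ler_pdivrMr// mul0r leNgt; apply/negP => ff.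
  have D2 := sqr_ge0 (b - b').
  have f0 : f != 0 by apply: contraTneq ff => ->; rewrite !mul0r ltxx.
  have f'0 : f' != 0 by apply: contraTneq ff => ->; rewrite mulr0 mul0r ltxx.
  have r2 := sqr_ge0 r; have r'2 := sqr_ge0 r'.
  have [fn|fp|] := ltgtP f 0; [|have [f'n|f'p|] := ltgtP f' 0|]; last 2 first.
  - by move/eqP; rewrite (negbTE f'0).
  - by move/eqP; rewrite (negbTE f0).
  - rewrite nmulr_lgt0// in h2.
    have [f'n|f'p|/eqP] := ltgtP f' 0; last by rewrite (negbTE f'0).
    + by rewrite nmulr_lgt0// in h1; lra.
    + by rewrite nmulr_rgt0 ?nmulr_rlt0// in ff; lra.
  - rewrite nmulr_lgt0// in h1.
    by rewrite nmulr_rgt0 ?pmulr_rlt0// in ff; lra.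
  rewrite pmulr_lgt0// in h1; rewrite pmulr_lgt0// in h2.
  rewrite pmulr_rgt0 ?mulr_gt0// in ff.
  have E1 : 0 < (b - b') ^+ 2 + r ^+ 2 - r' ^+ 2 by lra.
  have E2 : 0 < (b - b') ^+ 2 + r' ^+ 2 - r ^+ 2 by lra.
  have E3 : (b - b') ^+ 2 < r ^+ 2 + r' ^+ 2 by lra.
  have D0 : b - b' != 0.
    by apply: contraTneq E1 => D0; rewrite D0 in E2 *; apply/negP; lra.
  (* Radical axis: abscissa, relative to b', where the two circles would cross. A Heron-type
     identity shows t^2 < r'^2, so the crossing lies in H. *)
  pose t := ((b - b') ^+ 2 + r' ^+ 2 - r ^+ 2) / (2 * (b - b')).
  have tE : 2 * (b - b') * t = (b - b') ^+ 2 + r' ^+ 2 - r ^+ 2.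
    by rewrite /t; field.
  have t2 : 0 < r' ^+ 2 - t ^+ 2.
    have DD : 0 < 4 * (b - b') ^+ 2 by rewrite mulr_gt0// lt_neqAle D2 eq_sym sqrf_eq0 D0.
    rewrite -(pmulr_rgt0 _ DD).
    have -> : 4 * (b - b') ^+ 2 * (r' ^+ 2 - t ^+ 2) =
        4 * (b - b') ^+ 2 * r' ^+ 2 - (2 * (b - b') * t) ^+ 2 by ring.
    rewrite tE; set D := (b - b') ^+ 2 in E1 E2 E3 *.
    have -> : 4 * D * r' ^+ 2 - (D + r' ^+ 2 - r ^+ 2) ^+ 2 =
      (2 * r * r') ^+ 2 - (r ^+ 2 + r' ^+ 2 - D) ^+ 2 by ring.
    rewrite subr_gt0 ltr_pXn2r// ?nnegrE; [|lra|exact: ltW].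
    have : (r - r') ^+ 2 < D by have := sqr_ge0 (r - r'); nra.
    by nra.
  have := HL (b' + t, Num.sqrt (r' ^+ 2 - t ^+ 2)); rewrite /= sqrtr_gt0 sqr_sqrtr ?ltW//.
  have e1 : (b' + t - b') ^+ 2 + (r' ^+ 2 - t ^+ 2) - r' ^+ 2 = 0 by ring.
  move=> /(_ (conj t2 e1)).
  have -> : (b' + t - b) ^+ 2 + (r' ^+ 2 - t ^+ 2) - r ^+ 2 =
    (b - b') ^+ 2 + r' ^+ 2 - r ^+ 2 - 2 * (b - b') * t by ring.
  by rewrite tE subrr mul0r ltxx.
Qed.

(** Conformality: at a common point the Lorentz pairing and the Euclidean normals measure the same
    angle. *)
Lemma dot_lgrad L L' p : wf_hline L -> wf_hline L' ->
  lineset L p -> lineset L' p ->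
  exists2 k, 0 < k & lorentz (polar L) (polar L') = k * dot (lgrad L p) (lgrad L' p).
Proof.
case: L L' => [b|b r] [b'|b' r'] /= wfL wfL' [Hp +] [_]; rewrite /dot /lorentz /=.
- by exists 1 => //; field.
- move=> p1 p2; exists r'^-1; first by rewrite invr_gt0.
  have -> : p.1 = b by lra.
  by field; rewrite gt_eqF.
- move=> p1 p2; exists r^-1; first by rewrite invr_gt0.
  have -> : p.1 = b' by lra.
  by field; rewrite gt_eqF.
- move=> p1 p2; exists (r * r')^-1; first by rewrite invr_gt0 mulr_gt0.
  set d := _ + p.2 * _.
  have -> : d = (r ^+ 2 + r' ^+ 2 - (b - b') ^+ 2) / 2 by rewrite /d; nra.
  by field; rewrite !gt_eqF.
Qed.

Lemma enorm_gt0 (u : R * R) : dot u u != 0 -> 0 < enorm u.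
Proof.
move=> u0; rewrite /enorm sqrtr_gt0 lt_neqAle eq_sym u0.
by rewrite /dot addr_ge0// -expr2 sqr_ge0.
Qed.

Lemma enorm_lgrad_gt0 L p : lineset L p -> 0 < enorm (lgrad L p).
Proof.
move=> [Hp _]; apply: enorm_gt0; case: L => [b|b r]; rewrite /dot /=.
  by rewrite mulr0 addr0 mul1r oner_neq0.
rewrite gt_eqF// -!expr2; apply: ltr_wpDl; first exact: sqr_ge0.
by rewrite exprn_gt0.
Qed.

Lemma dot_norm_le (u v : R * R) : `|dot u v| <= enorm u * enorm v.
Proof.
rewrite /enorm -sqrtrM; last by rewrite /dot addr_ge0// -expr2 sqr_ge0.
rewrite -sqrtr_sqr ler_wsqrtr// /dot.
have := sqr_ge0 (u.1 * v.2 - u.2 * v.1); nra.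
Qed.

Lemma meeting_roots L L' z p (m : nat) : wf_hline L -> wf_hline L' ->
  lineset L p -> lineset L' p -> (2 <= m)%N ->
  angle_at L L' z p = pi / m%:R ->
  lorentz (hroot L z) (hroot L' z) <= 0.
Proof.
move=> wfL wfL' Lp L'p m2 ang; apply: lorentz_root_le0.
have [k k0 ->] := dot_lgrad wfL wfL' Lp L'p.
have g0 := enorm_lgrad_gt0 Lp; have g'0 := enorm_lgrad_gt0 L'p.
set s := Num.sg (lfun L z); set s' := Num.sg (lfun L' z).
have nnE : dot (unormal L z p) (unormal L' z p) =
    s * s' * dot (lgrad L p) (lgrad L' p) / (enorm (lgrad L p) * enorm (lgrad L' p)).
  by rewrite /unormal -/s -/s' {1}/dot /= /dot; field; rewrite !gt_eqF.
have nn0 : dot (unormal L z p) (unormal L' z p) <= 0.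
  (* Cauchy-Schwarz puts the argument of [acos] in [-1, 1]; then - n.n' is the cosine of pi / m, an
     angle of at most pi / 2. *)
  rewrite -oppr_ge0 -[leRHS]acosK; last first.
    rewrite in_itv /= -ler_norml normrN nnE normrM normfV ler_pdivrMr; last first.
      by rewrite normr_gt0 mulf_neq0 ?gt_eqF.
    rewrite mul1r [leRHS]gtr0_norm ?mulr_gt0// (le_trans _ (dot_norm_le _ _))//.
    rewrite normrM ler_piMl// normrM.
    by rewrite !normr_sg -natrM mulnb lern1 leq_b1.
  rewrite -/(angle_at L L' z p) ang; apply: cos_ge0_pihalf.
  have pi0 := pi_gt0 R.
  apply/andP; split.
    by rewrite (@le_trans _ _ 0)// ?oppr_le0 divr_ge0// ltW.
  by rewrite ler_pM2l// lef_pV2 ?posrE ?ler_nat// ltr0n (leq_trans _ m2).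
have : s * s' * dot (lgrad L p) (lgrad L' p) <= 0.
  by move: nn0; rewrite nnE ler_pdivrMr ?mulr_gt0// mul0r.
rewrite -sgr_le0 !sgrM !sgr_id => h.
by rewrite -sgr_le0 !sgrM (gtr0_sg k0) mul1r.
Qed.

Lemma pair_conditionP L L' z : wf_hline L -> wf_hline L' ->
  pair_condition L L' z ->
  lfun L z != 0 /\ lorentz (hroot L z) (hroot L' z) <= 0.
Proof.
move=> wfL wfL' [[LL' [Cz [LC L'C]]]|[m [m2 [Lz [L'z [p [Lp [L'p ang]]]]]]]].
  split.
    have [Hz nz] := connected_component_sub Cz.
    by apply/eqP => Lz; apply: nz; left.
  apply: disjoint_roots => //.
    exact: lineset_facing.
  rewrite setIC setUC in LL' Cz LC L'C.
  exact: lineset_facing.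
by split => //; exact: meeting_roots ang.
Qed.

End pair_condition.

(** * Chord metric and contraction on average *)

Section chord.
Variable R : realType.
Implicit Types (z : R * R) (x y : extR R) (L : hline R).

Definition circ1 z x : R := horo1 z (ray x).
Definition circ2 z x : R := horo2 z (ray x).

Definition chord z x y : R :=
  Num.sqrt ((circ1 z x - circ1 z y) ^+ 2 + (circ2 z x - circ2 z y) ^+ 2).

Lemma chord_ge0 z x y : 0 <= chord z x y.
Proof. exact: sqrtr_ge0. Qed.

Lemma chord_sqrE z x y : chord z x y ^+ 2 =
  (circ1 z x - circ1 z y) ^+ 2 + (circ2 z x - circ2 z y) ^+ 2.
Proof. by rewrite sqr_sqrtr// addr_ge0 ?sqr_ge0. Qed.

Lemma chord_sqr z x y : 0 < z.2 -> chord z x y ^+ 2 =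
  - (2 * lorentz (ray x) (ray y)) / (height z (ray x) * height z (ray y)).
Proof.
move=> z0; rewrite chord_sqrE horo_sqdist ?lorentz_ray//;
by rewrite gt_eqF ?height_ray_gt0.
Qed.

(** The quotient is homogeneous of degree 0 in each ray, so unnormalised folds may stand for the
    images. *)
Lemma chord_oneway_sqr L z x y : 0 < z.2 -> wf_hline L -> lfun L z != 0 ->
  let f u := fold (hroot L z) (ray u) in
  chord z (oneway L z x) (oneway L z y) ^+ 2 =
  - (2 * lorentz (f x) (f y)) / (height z (f x) * height z (f y)).
Proof.
move=> z0 wfL Lz f; rewrite chord_sqr//.
have [k k0 kE] := ray_oneway x wfL Lz; have [l l0 lE] := ray_oneway y wfL Lz.
have := height_ray_gt0 (oneway L z x) z0; have := height_ray_gt0 (oneway L z y) z0.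
rewrite kE lE !heightZ lorentzZl lorentzZr !pmulr_rgt0// -/(f x) -/(f y) => fx fy.
by field; rewrite !gt_eqF.
Qed.

(** In the quotient for the squared chord the numerator does not grow, the height of y does not
    drop, and the height of x gains the factor 1 + 2 c e. *)
Lemma chord_oneway_contract L z x y e : 0 < z.2 -> wf_hline L -> lfun L z != 0 ->
  0 <= e -> e * height z (ray x) <= Num.max 0 (lorentz (ray x) (hroot L z)) ->
  (1 + 2 * lorentz (hroot L z) (point z) * e) *
    chord z (oneway L z x) (oneway L z y) ^+ 2 <= chord z x y ^+ 2.
Proof.
move=> z0 wfL Lz e0 ex.
have c0 := lorentz_root_point wfL Lz.
rewrite chord_oneway_sqr// chord_sqr//.
set fx := fold _ (ray x); set fy := fold _ (ray y).
set c := lorentz _ (point z) in c0 *.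
have hx := height_ray_gt0 x z0; have hy := height_ray_gt0 y z0.
have hfy : height z (ray y) <= height z fy by apply: height_fold_ge; exact: ltW.
have hfx : (1 + 2 * c * e) * height z (ray x) <= height z fx.
  rewrite height_fold -/c mulrDl mul1r lerD2l -(mulrA (2 * c)).
  by rewrite ler_pM2l// mulr_gt0.
have B : lorentz (ray x) (ray y) <= lorentz fx fy.
  by apply: lorentz_fold; exact: lorentz_root.
have k0 : 0 < 1 + 2 * c * e by rewrite ltr_wpDr// !mulr_ge0// ltW.
have fx0 : 0 < height z fx by apply: lt_le_trans hfx; rewrite mulr_gt0.
have fy0 : 0 < height z fy by apply: lt_le_trans hfy.
have : 0 <= chord z (oneway L z x) (oneway L z y) ^+ 2 by rewrite sqr_ge0.
rewrite chord_oneway_sqr// -/fx -/fy pmulr_lge0 ?invr_gt0 ?mulr_gt0// => B0.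
rewrite mulrA ler_pdivrMr ?mulr_gt0// [leRHS]mulrAC ler_pdivlMr ?mulr_gt0//.
rewrite (_ : (1 + 2 * c * e) * - (2 * lorentz fx fy) *
    (height z (ray x) * height z (ray y)) =
  - (2 * lorentz fx fy) * (((1 + 2 * c * e) * height z (ray x)) * height z (ray y)));
  last by ring.
apply: ler_pM => //; [|lra|].
  by rewrite !mulr_ge0// ltW.
by apply: ler_pM => //; [rewrite mulr_ge0// ltW|exact: ltW].
Qed.

Lemma chord_oneway_le L z x y : 0 < z.2 -> wf_hline L -> lfun L z != 0 ->
  chord z (oneway L z x) (oneway L z y) <= chord z x y.
Proof.
move=> z0 wfL Lz.
rewrite -(ler_pXn2r (ltn0Sn 1)) ?nnegrE ?chord_ge0//.
have := @chord_oneway_contract L z x y 0 z0 wfL Lz (lexx _).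
by rewrite mul0r mulr0 addr0 mul1r; apply; rewrite le_max lexx.
Qed.

Lemma oneway_average_contract (L : 'I_3 -> hline R) z : 0 < z.2 ->
  (forall i, wf_hline (L i)) ->
  (forall i j, i != j -> pair_condition (L i) (L j) z) ->
  exists2 rho, 0 < rho < 1 & forall x y,
    \sum_(i < 3) chord z (oneway (L i) z x) (oneway (L i) z y) <=
    3 * rho * chord z x y.
Proof.
move=> z0 wfL pc.
pose i0 : 'I_3 := ord0; pose i1 : 'I_3 := lift ord0 ord0.
pose i2 : 'I_3 := lift ord0 (lift ord0 ord0).
have Lz i : lfun (L i) z != 0.
  have [j ij] : exists j, i != j.
    by have [->|] := eqVneq i i0; [exists i1|exists i0].
  by have [] := pair_conditionP (wfL i) (wfL j) (pc i j ij).
pose a i := hroot (L i) z.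
have aa i : lorentz (a i) (a i) = 1 by exact: lorentz_root.
have a0 i : 0 < lorentz (a i) (point z) by exact: lorentz_root_point.
have ab i j : i != j -> lorentz (a i) (a j) <= 0.
  by move=> ij; have [] := pair_conditionP (wfL i) (wfL j) (pc i j ij).
have [e e0 eP] := @roots_cover R (a i0) (a i1) (a i2) z z0 (aa _) (aa _) (aa _)
  (a0 _) (a0 _) (a0 _) (ab i0 i1 isT) (ab i0 i2 isT) (ab i1 i2 isT).
pose c := Num.min (lorentz (a i0) (point z))
  (Num.min (lorentz (a i1) (point z)) (lorentz (a i2) (point z))).
have c0 : 0 < c by rewrite !lt_min !a0.
pose k := 1 + 2 * c * e.
have k1 : 1 < k by rewrite ltrDl !mulr_gt0.
have k0 : 0 < k by exact: lt_trans k1.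
(* The map whose root covers x contracts by s and the other two are 1-Lipschitz, so the sum is at
   most (2 + s) times the chord. *)
pose s := Num.sqrt k^-1.
have s1 : s < 1 by rewrite -sqrtr1 ltr_sqrt// invf_lt1.
have s0 : 0 <= s by exact: sqrtr_ge0.
have s2 : s ^+ 2 = k^-1 by rewrite sqr_sqrtr// invr_ge0 ltW.
have contract i x y : c <= lorentz (a i) (point z) ->
    e * height z (ray x) <= lorentz (ray x) (a i) ->
    chord z (oneway (L i) z x) (oneway (L i) z y) <= s * chord z x y.
  move=> ci ex; rewrite -(ler_pXn2r (ltn0Sn 1)) ?nnegrE ?mulr_ge0 ?chord_ge0//.
  rewrite exprMn s2 [leRHS]mulrC ler_pdivlMr// mulrC.
  apply: le_trans (_ : _ <= (1 + 2 * lorentz (a i) (point z) * e) * _) _.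
    by apply: ler_wpM2r; [exact: sqr_ge0|rewrite lerD2l ler_pM2r// ler_pM2l].
  by apply: chord_oneway_contract => //; [exact: ltW|rewrite le_max ex orbT].
exists ((2 + s) / 3); first by lra.
move=> x y; rewrite !big_ord_recl big_ord0 addr0.
have le i := chord_oneway_le x y z0 (wfL i) (Lz i).
have := le i0; have := le i1; have := le i2.
have -> : 3 * ((2 + s) / 3) = 2 + s by field.
have ci0 : c <= lorentz (a i0) (point z) by rewrite !ge_min lexx.
have ci1 : c <= lorentz (a i1) (point z) by rewrite !ge_min lexx orbT.
have ci2 : c <= lorentz (a i2) (point z) by rewrite !ge_min lexx !orbT.
have [/(contract i0 x y ci0)|/(contract i1 x y ci1)|/(contract i2 x y ci2)] := eP x;
  rewrite /i0 /i1 /i2; lra.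
Qed.

End chord.

(** * Measurability on the circle at infinity *)

Section extR_measurability.
Variable R : realType.
Implicit Types (z : R * R) (x y : extR R) (L : hline R).

Lemma measurable_invr : measurable_fun [set: R] (@GRing.inv R).
Proof.
(* A real power of the nonnegative t^2; at 0 both sides are 0 by convention. *)
have -> : @GRing.inv R = (fun t : R => t * (t ^+ 2) `^ (-1)).
  apply/funext => t; rewrite powR_inv1 ?sqr_ge0// expr2 invfM.
  by have [->|t0] := eqVneq t 0; rewrite ?invr0 ?mul0r// mulrA divff// mul1r.
apply: measurable_funM => //.
apply: (@measurableT_comp _ _ _ _ _ _ (fun u : R => u `^ (-1))).
  exact: measurable_powR.
exact: exprn_measurable.
Qed.

Lemma measurable_extR d (T : measurableType d) (f : extR R -> T) :
  measurable_fun [set: R] (f \o @Some R) -> measurable_fun [set: extR R] f.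
Proof.
move=> mf _ A mA; rewrite setTI.
by have := mf measurableT A mA; rewrite setTI.
Qed.

Lemma measurable_Some d (T : measurableType d) (f : T -> R) :
  measurable_fun [set: T] f ->
  measurable_fun [set: T] (fun t => Some (f t) : extR R).
Proof. by move=> mf _ A mA; exact: (mf measurableT _ mA). Qed.

Lemma measurable_some_image (B : set R) : measurable B ->
  measurable (@Some R @` B : set (extR R)).
Proof.
move=> mB; suff : extR_measurable (@Some R @` B : set (extR R)) by [].
rewrite /extR_measurable (_ : _ @^-1` _ = B)//; apply/seteqP; split => b /=.
  by move=> [c Bc [<-]].
by exists b.
Qed.

Lemma measurable_oneway L z : measurable_fun [set: extR R] (oneway L z).
Proof.
apply: measurable_extR; rewrite /oneway /comp /=.
have mid : measurable_fun [set: R] (fun t : R => t) by exact: measurable_id.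
have msub (b : R) : measurable_fun [set: R] (fun t : R => t - b).
  by apply: measurable_funB.
apply: measurable_fun_ifT; last exact: measurable_Some.
  apply: measurable_fun_ltr => //; apply: measurable_funM => //.
  case: L => [b|b r] /=; first exact: msub.
  apply: measurable_funB => //; apply: measurable_funD => //.
  exact: measurable_funX.
case: L => [b|b r] /=.
  by apply: measurable_Some; apply: measurable_funB.
apply: measurable_fun_ifT; first exact: measurable_fun_eqr.
  exact: measurable_cst.
apply: measurable_Some; apply: measurable_funD => //.
apply: measurable_funM => //.
exact: (measurableT_comp measurable_invr (msub b)).
Qed.

Lemma measurable_circ1 z : measurable_fun [set: extR R] (circ1 z).
Proof.
apply: measurable_extR; rewrite /circ1 /horo1 /comp /=.
apply: measurable_funM; first by apply: measurable_funB.
apply: (measurableT_comp measurable_invr).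
rewrite /height /lorentz /=; apply: measurable_funN; apply: measurable_funB.
  exact: measurable_funM.
apply: measurable_funM => //; apply: measurable_funD => //.
by apply: measurable_funM => //; exact: measurable_funX.
Qed.

Lemma measurable_circ2 z : measurable_fun [set: extR R] (circ2 z).
Proof.
apply: measurable_extR; rewrite /circ2 /horo2 /comp /=.
apply: measurable_funM => //.
apply: (measurableT_comp measurable_invr).
rewrite /height /lorentz /=; apply: measurable_funN; apply: measurable_funB.
  exact: measurable_funM.
apply: measurable_funM => //; apply: measurable_funD => //.
by apply: measurable_funM => //; exact: measurable_funX.
Qed.

Lemma measurable_sqrtr : measurable_fun [set: R] (@Num.sqrt R).
Proof. by apply: continuous_measurable_fun; exact: sqrt_continuous. Qed.

Lemma measurable_chord d (T : measurableType d) z (f g : T -> extR R) :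
  measurable_fun [set: T] f -> measurable_fun [set: T] g ->
  measurable_fun [set: T] (fun t => chord z (f t) (g t)).
Proof.
move=> mf mg; apply: (measurableT_comp measurable_sqrtr).
have m1 := measurable_circ1 z; have m2 := measurable_circ2 z.
apply: measurable_funD; apply: measurable_funX; apply: measurable_funB.
- exact: (measurableT_comp m1 mf).
- exact: (measurableT_comp m1 mg).
- exact: (measurableT_comp m2 mf).
- exact: (measurableT_comp m2 mg).
Qed.

(** A generating pi-system; the whole circle is included because compact intervals never reach ∞. *)
Definition closed_arcs : set (set (extR R)) :=
  [set A | A = setT \/ exists c d : R, A = @Some R @` `[c, d]%classic].

Lemma setI_closed_arcs : setI_closed closed_arcs.
Proof.
move=> A B [->|[c [d ->]]]; first by rewrite setTI.
move=> [->|[c' [d' ->]]]; first by rewrite setIT; right; exists c, d.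
right; exists (Num.max c c'), (Num.min d d').
apply/seteqP; split => [x [[t tcd <-] [u ucd [E]]]|x [t]] /=.
  subst u; exists t => //; move: tcd ucd; rewrite /= !in_itv /=.
  by rewrite ge_max le_min => /andP[-> ->] /andP[-> ->].
rewrite /= in_itv /= ge_max le_min => /andP[/andP[h1 h2] /andP[h3 h4]] <-.
by split; exists t => //=; rewrite in_itv /= ?h1 ?h2 ?h3 ?h4.
Qed.

Lemma closed_arcs_gen : @measurable _ (extR R) = <<s closed_arcs >>.
Proof.
apply/seteqP; split; last first.
  apply: smallest_sub; first exact: sigma_algebra_measurable.
  move=> _ [->|[c [d ->]]]; first exact: measurableT.
  by apply: measurable_some_image.
have [S0 SC SU] : sigma_algebra setT <<s closed_arcs >>.
  exact: smallest_sigma_algebra.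
have ST : <<s closed_arcs >> setT by apply: sub_gen_smallest; left.
have SUn A B : <<s closed_arcs >> A -> <<s closed_arcs >> B ->
    <<s closed_arcs >> (A `|` B).
  by move=> SA SB; rewrite -bigcup2E; apply: SU => -[|[|n]].
have SD A B : <<s closed_arcs >> A -> <<s closed_arcs >> B ->
    <<s closed_arcs >> (A `\` B).
  move=> SA SB; rewrite (_ : A `\` B = setT `\` ((setT `\` A) `|` B)); last first.
    by rewrite !setTD setCU setCK setDE.
  by apply: (SC _ (SUn _ _ _ SB)); exact: SC.
(* Good-sets argument: H is a sigma-algebra on R containing the rays [c, +oo[, hence all Borel sets.
   The point ∞ is recovered by complements. *)
pose H : set (set R) := [set B | <<s closed_arcs >> (@Some R @` B)].
have Hray c : H `[c, +oo[%classic.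
  rewrite /H /= (_ : @Some R @` _ = \bigcup_n (@Some R @` `[c, c + n%:R]%classic)).
    by apply: SU => n; apply: sub_gen_smallest; right; exists c, (c + n%:R).
  apply/seteqP; split => [x [t]|x [n _ [t]]] /=; rewrite in_itv /=.
    rewrite andbT => ct <-; exists (Num.truncn (t - c)).+1 => //.
    exists t => //=; rewrite in_itv /= ct /= addrC -lerBlDr.
    exact/ltW/truncnS_gt.
  by move=> /andP[ct _] <-; exists t => //=; rewrite in_itv /= ct.
have HT : H setT.
  rewrite /H /= (_ : [set: R] = \bigcup_n `[- n%:R, +oo[%classic).
    by rewrite image_bigcup; apply: SU => n; exact: Hray.
  apply/seteqP; split => // t _; exists (Num.truncn (- t)).+1 => //=.
  rewrite in_itv /= andbT lerNl; exact/ltW/truncnS_gt.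
have sH : sigma_algebra setT H.
  split.
  - by rewrite /H /= image_set0.
  - move=> B HB; rewrite /H /= (_ : _ @` _ = (@Some R @` setT) `\` (@Some R @` B)).
      exact: SD.
    apply/seteqP; split => [x [t [_ nB] <-]|x [[t _ <-] nB]].
      by split; [exists t|move=> [u Bu [E]]; apply: nB; rewrite -E].
    by exists t => //; split => // Bt; apply: nB; exists t.
  - by move=> B HB; rewrite /H /= image_bigcup; exact: SU.
move=> A mA.
have mA' : H (@Some R @^-1` A).
  have : (@ocitv R).-sigma.-measurable (@Some R @^-1` A) by exact: mA.
  rewrite RGenCInfty.measurableE; apply: smallest_sub => //.
  by move=> _ [c ->]; exact: Hray.
have [AN|AN] := pselect (A None).
  rewrite (_ : A = setT `\` ((@Some R @` setT) `\` (@Some R @` (@Some R @^-1` A)))).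
    by apply: (SD _ _ ST); exact: SD.
  apply/seteqP; split => [[b|] Ab|[b|] /=].
  - by split => // -[_]; apply; exists b.
  - by split => // -[[]].
  - move=> [_ h]; apply: contrapT => Ab; apply: h; split; first by exists b.
    by move=> [c Ac [E]]; apply: Ab; rewrite -E.
  - by [].
rewrite (_ : A = @Some R @` (@Some R @^-1` A))//.
apply/seteqP; split => [[b|] Ab|x [b Ab <-]//]; last by [].
by exists b.
Qed.

End extR_measurability.

(** * Explicit circle coordinates and arcs *)

Section circle_coordinates.
Variable R : realType.
Implicit Types (z : R * R) (x y : extR R).

Lemma height_some z (t : R) :
  height z (ray (Some t)) = ((t - z.1) ^+ 2 + z.2 ^+ 2) / 2.
Proof. by rewrite /height /lorentz /=; field. Qed.

Lemma circ1_some z (t : R) : 0 < z.2 ->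
  circ1 z (Some t) = 2 * (t - z.1) / ((t - z.1) ^+ 2 + z.2 ^+ 2).
Proof.
move=> z0; rewrite /circ1 /horo1 height_some /=; field.
by rewrite gt_eqF// ltr_wpDl ?sqr_ge0// exprn_gt0.
Qed.

Lemma circ2_some z (t : R) : 0 < z.2 ->
  circ2 z (Some t) = 2 * z.2 / ((t - z.1) ^+ 2 + z.2 ^+ 2).
Proof.
move=> z0; rewrite /circ2 /horo2 height_some /=; field.
by rewrite gt_eqF// ltr_wpDl ?sqr_ge0// exprn_gt0.
Qed.

Lemma circ1_None z : circ1 z None = 0.
Proof. by rewrite /circ1 /horo1 /= mulr0 subrr mul0r. Qed.

Lemma circ2_None z : circ2 z None = 0.
Proof. by rewrite /circ2 /horo2 /= mulr0 mul0r. Qed.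

Lemma sqdist_gt0 z (t : R) : 0 < z.2 -> 0 < (t - z.1) ^+ 2 + z.2 ^+ 2.
Proof. by move=> z0; rewrite ltr_wpDl ?sqr_ge0// exprn_gt0. Qed.

(** The coordinates lie on the circle of radius 1 / z.2 centred at (0, 1 / z.2), with ∞ at the
    origin. *)
Lemma circ1_bound z x : 0 < z.2 -> `|circ1 z x| <= z.2^-1.
Proof.
move=> z0; case: x => [t|]; last by rewrite circ1_None normr0 invr_ge0 ltW.
have h0 := sqdist_gt0 t z0.
rewrite circ1_some// normrM normfV (gtr0_norm h0) ler_pdivrMr//.
rewrite [leRHS]mulrC ler_pdivlMr//.
have := sqr_ge0 (`|t - z.1| - z.2).
rewrite normrM (gtr0_norm (ltr0Sn _ 1)) sqrrB -normrX (ger0_norm (sqr_ge0 _)); lra.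
Qed.

Lemma circ2_bound z x : 0 < z.2 -> `|circ2 z x| <= 2 / z.2.
Proof.
move=> z0; case: x => [t|]; last by rewrite circ2_None normr0 divr_ge0// ltW.
have h0 := sqdist_gt0 t z0.
rewrite circ2_some// normrM normfV (gtr0_norm h0) ler_pdivrMr//.
rewrite mulrAC ler_pdivlMr// gtr0_norm ?mulr_gt0//.
have := sqr_ge0 (t - z.1); nra.
Qed.

Lemma circ1_chord z x y : `|circ1 z x - circ1 z y| <= chord z x y.
Proof. by rewrite -sqrtr_sqr ler_wsqrtr// lerDl sqr_ge0. Qed.

Lemma circ2_chord z x y : `|circ2 z x - circ2 z y| <= chord z x y.
Proof. by rewrite -sqrtr_sqr ler_wsqrtr// lerDr sqr_ge0. Qed.

Lemma chord_bound z x y : 0 < z.2 -> chord z x y <= 6 / z.2.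
Proof.
move=> z0; have M0 : 0 <= 6 / z.2 by rewrite divr_ge0// ltW.
rewrite -(ler_pXn2r (ltn0Sn 1)) ?nnegrE ?chord_ge0// chord_sqrE.
have /ler_normlP[h1 h2] := circ1_bound x z0.
have /ler_normlP[h3 h4] := circ1_bound y z0.
have /ler_normlP[h5 h6] := circ2_bound x z0.
have /ler_normlP[h7 h8] := circ2_bound y z0.
have b0 : 0 < z.2^-1 by rewrite invr_gt0.
rewrite exprMn; set b := z.2^-1 in h1 h2 h3 h4 h5 h6 h7 h8 b0 *.
have : (circ1 z x - circ1 z y) ^+ 2 <= (2 * b) ^+ 2.
  by rewrite -[leLHS]real_normK ?num_real// ler_pXn2r ?nnegrE ?ler_norml//; lra.
have : (circ2 z x - circ2 z y) ^+ 2 <= (4 * b) ^+ 2.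
  by rewrite -[leLHS]real_normK ?num_real// ler_pXn2r ?nnegrE ?ler_norml//; lra.
rewrite !exprMn; have := sqr_ge0 b; lra.
Qed.

(* An arc is cut out of the circle by a chord, hence the affine form. *)
Lemma closed_arcE z (c d : R) : 0 < z.2 -> c <= d -> exists A B : R, forall x,
  (2 + A * circ1 z x + B * circ2 z x <= 0) <-> (@Some R @` `[c, d]%classic) x.
Proof.
move=> z0 cd.
(* Chosen so that at t the affine form equals 2 (t - c) (t - d) / ((t - z.1)^2 + z.2^2); at ∞ it is
   2 > 0. *)
exists (2 * z.1 - c - d), (((z.1 - c) * (z.1 - d) - z.2 ^+ 2) / z.2) => -[t|]; last first.
  rewrite circ1_None circ2_None !mulr0 !addr0; split; first by lra.
  by move=> [].
have h0 := sqdist_gt0 t z0.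
rewrite circ1_some// circ2_some//.
have -> : 2 + (2 * z.1 - c - d) * (2 * (t - z.1) / ((t - z.1) ^+ 2 + z.2 ^+ 2)) +
    ((z.1 - c) * (z.1 - d) - z.2 ^+ 2) / z.2 *
      (2 * z.2 / ((t - z.1) ^+ 2 + z.2 ^+ 2)) =
    2 * ((t - c) * (t - d)) / ((t - z.1) ^+ 2 + z.2 ^+ 2).
  by field; rewrite (gt_eqF h0) (gt_eqF z0).
rewrite ler_pdivrMr// mul0r pmulr_rle0//; split => [tcd|[u]] /=.
  by exists t => //=; rewrite in_itv /=; apply/andP; split; nra.
by rewrite in_itv /= => /andP[cu ud] [<-]; nra.
Qed.

End circle_coordinates.

(** * Stationary measures and the dual averaging operator *)

Section stationary.
Context d (T : measurableType d) (R : realType).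
Variable tau : 'I_3 -> T -> T.

Definition stationary (nu : set T -> \bar R) := forall A, measurable A ->
  (nu A = ((3 : R)^-1)%:E * \sum_(i < 3) pushforward nu (tau i) A)%E.

Definition average (f : T -> R) (x : T) : R := 3^-1 * \sum_(i < 3) f (tau i x).

Lemma average_ge0 f : (forall x, 0 <= f x) -> forall x, 0 <= average f x.
Proof. by move=> f0 x; rewrite mulr_ge0 ?invr_ge0// sumr_ge0. Qed.

Hypothesis mtau : forall i, measurable_fun [set: T] (tau i).

Lemma measurable_average f : measurable_fun [set: T] f ->
  measurable_fun [set: T] (average f).
Proof.
move=> mf; apply: measurable_funM => //; apply: measurable_sum => i.
exact: measurableT_comp.
Qed.

Lemma stationary_integral (nu : {measure set T -> \bar R}) (f : T -> R) :
  stationary nu -> measurable_fun [set: T] f -> (forall x, 0 <= f x) ->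
  (\int[nu]_x (f x)%:E = \int[nu]_x (average f x)%:E)%E.
Proof.
move=> st mf f0.
pose m (n : nat) : {measure set T -> \bar R} :=
  measure_function_pushforward__canonical__measure_function_Measure
    nu (mtau (inord n)).
have mf' i : measurable_fun [set: T] (fun x => (f (tau i x))%:E).
  by apply/measurable_EFinP; exact: measurableT_comp.
have k0 : 0 <= (3 : R)^-1 by rewrite invr_ge0.
(* Stationarity replaces nu by the mixture of its pushforwards; the rest is change of variables. *)
rewrite (@eq_measure_integral _ _ _ _ (mscale (NngNum k0) (msum m 3))); last first.
  move=> A mA _; rewrite st// /mscale /= /msum; congr (_ * _)%E.
  by apply: eq_bigr => i _; rewrite /= inord_val.
rewrite ge0_integral_mscale//=; [|exact/measurable_EFinP|by move=> x _; rewrite lee_fin].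
rewrite ge0_integral_measure_sum//; [|by move=> x _; rewrite lee_fin|exact/measurable_EFinP].
have -> : (fun x => (average f x)%:E) =
    (fun x => ((3 : R)^-1)%:E * \sum_(i < 3) (f (tau i x))%:E)%E.
  by apply/funext => x; rewrite /average EFinM sumEFin.
rewrite ge0_integralZl//; last 2 first.
- exact: emeasurable_sum.
- by move=> x _; apply: sume_ge0 => i _; rewrite lee_fin.
congr (_ * _)%E; rewrite ge0_integral_sum//; last by move=> i x _; rewrite lee_fin.
apply: eq_bigr => i _; rewrite /m /= inord_val ge0_integral_pushforward//.
- exact/measurable_EFinP.
- by move=> x _; rewrite lee_fin.
Qed.

End stationary.

(** * Uniqueness of the stationary measure *)

Section uniqueness.
Variables (R : realType) (z : R * R) (tau : 'I_3 -> extR R -> extR R) (rho : R).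
Hypothesis z_gt0 : 0 < z.2.
Hypothesis mtau : forall i, measurable_fun [set: extR R] (tau i).
Hypothesis rho01 : 0 <= rho < 1.
Hypothesis contract : forall x y,
  \sum_(i < 3) chord z (tau i x) (tau i y) <= 3 * rho * chord z x y.

Definition lipschitz_chord (C : R) (f : extR R -> R) :=
  forall x y, `|f x - f y| <= C * chord z x y.

Lemma average_lipschitz C f : 0 <= C -> lipschitz_chord C f ->
  lipschitz_chord (rho * C) (average tau f).
Proof.
move=> C0 lf x y; rewrite /average -mulrBr -sumrB normrM ger0_norm ?invr_ge0//.
rewrite ler_pdivrMl//; apply: le_trans (ler_norm_sum _ _ _) _.
apply: (@le_trans _ _ (\sum_(i < 3) C * chord z (tau i x) (tau i y))).
  exact: ler_sum.
rewrite -mulr_sumr; have := ler_wpM2l C0 (contract x y); lra.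
Qed.

(** Iterated averages keep the integrals of f but have Lipschitz constant rho^n C, so on the bounded
    circle they become nearly constant and both integrals approach the same value. *)
Lemma stationary_integral_le (nu mu : probability (extR R) R) (f : extR R -> R) C :
  stationary tau nu -> stationary tau mu -> 0 <= C -> lipschitz_chord C f ->
  measurable_fun [set: extR R] f -> (forall x, 0 <= f x) ->
  (\int[nu]_x (f x)%:E <= \int[mu]_x (f x)%:E)%E.
Proof.
move=> snu smu C0 lf mf f0.
pose g n := iter n (average tau) f.
have [g0 [mg [lg gI]]] : (forall n x, 0 <= g n x) /\
    ((forall n, measurable_fun [set: extR R] (g n)) /\
    ((forall n, lipschitz_chord (rho ^+ n * C) (g n)) /\
    forall n (m : probability (extR R) R), stationary tau m ->
      (\int[m]_x (f x)%:E = \int[m]_x (g n x)%:E)%E)).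
  have rho0 : 0 <= rho by case/andP: rho01.
  split; first by elim=> [//|n IH] x; exact: average_ge0.
  split; first by elim=> [//|n IH]; exact: measurable_average.
  split.
    elim=> [|n IH]; first by rewrite mul1r.
    by rewrite exprS -mulrA; apply: average_lipschitz => //; rewrite mulr_ge0// exprn_ge0.
  move=> n m sm; elim: n => [//|n IH]; rewrite IH (stationary_integral mtau sm)//.
  - by elim: n {IH} => [//|n IH]; exact: measurable_average.
  - by elim: n {IH} => [//|n IH] x; exact: average_ge0.
apply/lee_addgt0Pr => e e0.
(* Twice C times the diameter bound: each integral is within eta of g_n(∞), and 2 eta = rho^n K. *)
pose K := 2 * C * (6 / z.2).
have rho1 : `|rho| < 1 by case/andP: rho01 => ? ?; rewrite ger0_norm.
have [n nK] : exists n, rho ^+ n * K < e.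
  have /cvgrPdist_lt /(_ e e0) [n _ /(_ n (leqnn n))] := cvg_geometric K rho1.
  rewrite /geometric /= sub0r normrN => h; exists n; rewrite mulrC.
  exact: le_lt_trans (ler_norm _) h.
pose eta := rho ^+ n * C * (6 / z.2).
have eta0 : 0 <= eta.
  rewrite /eta !mulr_ge0 ?exprn_ge0 ?invr_ge0 ?(ltW z_gt0)//.
  by case/andP: rho01.
have osc x : `|g n x - g n None| <= eta.
  apply: le_trans (lg n x None) _; apply: ler_wpM2l; last exact: chord_bound.
  by rewrite mulr_ge0 ?exprn_ge0//; case/andP: rho01.
have mgE : measurable_fun [set: extR R] (fun x => (g n x)%:E).
  by apply/measurable_EFinP; exact: mg.
rewrite (gI n nu snu) (gI n mu smu).
have up : (\int[nu]_x (g n x)%:E <= (g n None + eta)%:E)%E.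
  rewrite -[leRHS]mule1 -(probability_setT nu) -integral_cst//.
  apply: ge0_le_integral => //=; first by move=> x _; rewrite lee_fin.
  move=> x _; rewrite lee_fin; have := osc x; rewrite ler_norml => /andP[_]; lra.
have lo : ((g n None)%:E <= \int[mu]_x (g n x)%:E + eta%:E)%E.
  rewrite -[leLHS]mule1 -(probability_setT mu) -integral_cst//.
  rewrite -[eta%:E]mule1 -(probability_setT mu) -integral_cst//.
  rewrite -ge0_integralD//=; last by move=> x _; rewrite lee_fin.
  apply: ge0_le_integral => //=.
  - by move=> x _; rewrite lee_fin.
  - exact: emeasurable_funD.
  - move=> x _; rewrite -EFinD lee_fin; have := osc x; rewrite ler_norml => /andP[]; lra.
apply: (le_trans up); rewrite EFinD.
apply: (@le_trans _ _ (\int[mu]_x (g n x)%:E + eta%:E + eta%:E)%E).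
  exact: leeD2r.
rewrite -addeA leeD2l// -EFinD lee_fin.
by move: nK; rewrite /K /eta; lra.
Qed.

(** The arc is {G <= 0} with G Lipschitz. The Lipschitz cut-off h is 1 on the arc and 0 off F k, and
    F k decreases to the arc, so nu(arc) <= int h dnu <= int h dmu <= mu(F k) gives the bound in the
    limit. *)
Lemma stationary_arc_le (nu mu : probability (extR R) R) (c d : R) :
  stationary tau nu -> stationary tau mu ->
  (nu (@Some R @` `[c, d]%classic) <= mu (@Some R @` `[c, d]%classic))%E.
Proof.
move=> snu smu; have [dc|cd] := ltP d c.
  rewrite (_ : `[c, d]%classic = set0) ?image_set0 ?measure0//.
  by rewrite set_itv_ge// bnd_simp -ltNge.
have [A [B AB]] := closed_arcE z_gt0 cd.
pose G x := 2 + A * circ1 z x + B * circ2 z x.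
have mG : measurable_fun [set: extR R] G.
  apply: measurable_funD; first apply: measurable_funD => //.
    by apply: measurable_funM => //; exact: measurable_circ1.
  by apply: measurable_funM => //; exact: measurable_circ2.
have lG : lipschitz_chord (`|A| + `|B|) G.
  move=> x y; rewrite /G.
  have -> : 2 + A * circ1 z x + B * circ2 z x - (2 + A * circ1 z y + B * circ2 z y) =
    A * (circ1 z x - circ1 z y) + B * (circ2 z x - circ2 z y) by ring.
  rewrite mulrDl; apply: le_trans (ler_normD _ _) _; rewrite !normrM.
  by apply: lerD; apply: ler_wpM2l => //; [exact: circ1_chord|exact: circ2_chord].
pose F (k : nat) := [set x | k.+1%:R * G x < 1].
have mF k : measurable (F k).
  rewrite (_ : F k = (fun x => k.+1%:R * G x) @^-1` [set t | t < 1])//.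
  rewrite -[X in measurable X]setTI; apply: measurable_funM => //.
  by rewrite (_ : [set t | t < 1] = `]-oo, 1[%classic)//; apply/seteqP; split => t /=; rewrite in_itv.
have FA : \bigcap_k F k = @Some R @` `[c, d]%classic.
  apply/seteqP; split => x.
    move=> Fx; apply/AB; rewrite leNgt; apply/negP => Gx.
    (* For this k, k + 1 exceeds 1 / G x, so a point with G x > 0 leaves F k. *)
    have := Fx (Num.truncn (G x)^-1) I; rewrite /F /=.
    by rewrite ltNge -ler_pdivrMr// div1r (ltW (truncnS_gt _)).
  move=> /AB Gx k _; rewrite /F /=; apply: le_lt_trans ltr01.
  by rewrite pmulr_rle0.
have mA : measurable (@Some R @` `[c, d]%classic : set (extR R)).
  exact: measurable_some_image.
have cF : (mu \o F) k @[k --> \oo] --> mu (@Some R @` `[c, d]%classic).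
  rewrite -FA; apply: nonincreasing_cvg_mu => //.
  - by apply: le_lt_trans (probability_le1 mu (mF 0%N)) _; rewrite ltry.
  - by rewrite FA.
  move=> k l kl; apply/subsetPset => x; rewrite /F /= => Gx.
  have [G0|G0] := leP (G x) 0.
    by apply: le_lt_trans ltr01; rewrite pmulr_rle0.
  by apply: le_lt_trans Gx; rewrite ler_pM2r// ler_nat.
apply: (cvge_to_ge cF); apply: nearW => k /=.
pose h x := Num.max 0 (1 - k.+1%:R * Num.max 0 (G x)).
have mh : measurable_fun [set: extR R] h.
  apply: measurable_maxr => //; apply: measurable_funB => //.
  by apply: measurable_funM => //; apply: measurable_maxr.
have h0 x : 0 <= h x by rewrite /h le_max lexx.
have mhE : measurable_fun [set: extR R] (fun x => (h x)%:E) by exact/measurable_EFinP.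
have mI (S : set (extR R)) : measurable S ->
    measurable_fun [set: extR R] (fun x => (\1_S x)%:E : \bar R).
  by move=> mS; apply/measurable_EFinP; exact: measurable_indic.
rewrite -[X in nu X]setIT -integral_indic//.
apply: (@le_trans _ _ (\int[nu]_x (h x)%:E)%E).
  apply: ge0_le_integral => //=; first exact: mI.
  move=> x _; rewrite lee_fin indicE; case: (boolP (x \in _)) => /= [|_]; last exact: h0.
  rewrite inE => /AB Gx; rewrite /h (max_l Gx) mulr0 subr0 le_max lexx orbT//.
apply: (@le_trans _ _ (\int[mu]_x (h x)%:E)%E).
  apply: (@stationary_integral_le _ _ _ (k.+1%:R * (`|A| + `|B|))) => //.
  move=> x y; rewrite -mulrA.
  have maxlip (s t : R) : `|Num.max 0 s - Num.max 0 t| <= `|s - t|.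
    rewrite ler_norml; have := ler_norm (s - t); have := ler_norm (- (s - t)); rewrite normrN.
    by case: (leP 0 s) => ?; case: (leP 0 t) => ?; lra.
  apply: le_trans (maxlip _ _) _.
  rewrite (_ : _ - _ = k.+1%:R * (Num.max 0 (G y) - Num.max 0 (G x))); last by ring.
  rewrite normrM (ger0_norm (ler0n _ _)) ler_pM2l//.
  by apply: le_trans (maxlip _ _) _; rewrite distrC; exact: lG.
rewrite -[X in mu X]setIT -integral_indic//.
apply: ge0_le_integral => //=; [by move=> x _; rewrite lee_fin|exact: mI|].
move=> x _; rewrite lee_fin indicE; case: (boolP (x \in _)) => /= [_|].
  rewrite /h ge_max ler01 /= gerBl mulr_ge0// le_max lexx//.
rewrite notin_setE /F /= => /negP; rewrite -leNgt => Gx.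
have Gp : 0 <= G x by have := ltr0Sn R k; nra.
by rewrite /h (max_r Gp) max_l// subr_le0.
Qed.

Lemma stationary_unique (nu mu : probability (extR R) R) :
  stationary tau nu -> stationary tau mu ->
  forall A, measurable A -> nu A = mu A.
Proof.
move=> snu smu; apply: (measure_unique (@closed_arcs R) (fun=> setT)).
- exact: closed_arcs_gen.
- exact: setI_closed_arcs.
- by left.
- by apply/seteqP; split => // x _; exists 0%N.
- move=> _ [->|[c [d ->]]]; first exact: (etrans (probability_setT nu) (esym (probability_setT mu))).
  by apply/eqP; rewrite eq_le; apply/andP; split; exact: stationary_arc_le.
- by move=> _; exact: le_lt_trans (probability_le1 nu measurableT) (ltry _).
Qed.

End uniqueness.

(** * Ternary digits of a uniform variable *)

Section ternary_digits.
Variable R : realType.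

Definition digit (t : R) : 'I_3 :=
  if t < 3^-1 then @Ordinal 3 0 isT
  else if t < 2 / 3 then @Ordinal 3 1 isT else @Ordinal 3 2 isT.

Definition branch (i : 'I_3) (t : R) : R := 3 * t - i%:R.

Definition digit_tail (t : R) : R := branch (digit t) t.

Definition unit_itv : set R := `[0, 1[%classic.

Lemma measurable_unit_itv : measurable unit_itv.
Proof. exact: measurable_itv. Qed.

Lemma lebesgue_unit_itv : lebesgue_measure unit_itv = 1%E.
Proof. by rewrite lebesgue_measure_itv /= lte_fin ltr01 oppr0 adde0. Qed.

Lemma measurable_branch i : measurable_fun [set: R] (branch i).
Proof. by apply: measurable_funB => //; apply: measurable_funM. Qed.

Lemma measurable_branch_preimage i : measurable (branch i @^-1` unit_itv).
Proof.
rewrite -[X in measurable X]setTI; apply: measurable_branch => //.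
exact: measurable_unit_itv.
Qed.

Lemma digit_branch i t : unit_itv (branch i t) -> digit t = i.
Proof.
rewrite /unit_itv /= in_itv /= /branch /digit => /andP[h1 h2].
apply/val_inj; case: i h1 h2 => -[|[|[|//]]] ? /= h1 h2;
  by case: (ltP t 3^-1) => ?; [|case: (ltP t (2 / 3)) => ?] => //; exfalso; lra.
Qed.

Lemma unit_itv_branch :
  unit_itv = \big[setU/set0]_(i <- index_enum 'I_3) branch i @^-1` unit_itv.
Proof.
rewrite -bigcup_seq; apply/seteqP; split => t; last first.
  move=> [i _]; rewrite /unit_itv /= !in_itv /= /branch.
  have : (i%:R : R) <= 2 by rewrite (ler_nat R _ 2) -ltnS.
  have : 0 <= (i%:R : R) by [].
  by move=> ? ? /andP[? ?]; apply/andP; split; lra.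
rewrite /unit_itv /= in_itv /= => /andP[t0 t1].
exists (digit t); first by rewrite /= mem_index_enum.
rewrite /= in_itv /= /branch /digit.
have [h1|h1] := ltP t 3^-1 => /=; first by apply/andP; split; lra.
by have [h2|h2] := ltP t (2 / 3) => /=; apply/andP; split; lra.
Qed.

Lemma measurable_digit d (T : measurableType d) (f : 'I_3 -> R -> T) :
  (forall i, measurable_fun [set: R] (f i)) ->
  measurable_fun [set: R] (fun t => f (digit t) (digit_tail t)).
Proof.
move=> mf; pose g i t := f i (branch i t).
have mg i : measurable_fun [set: R] (g i).
  exact: (measurableT_comp (mf i) (measurable_branch i)).
rewrite (_ : (fun _ => _) = (fun t => if t < 3^-1 then g (@Ordinal 3 0 isT) t
    else if t < 2 / 3 then g (@Ordinal 3 1 isT) t else g (@Ordinal 3 2 isT) t)).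
  apply: measurable_fun_ifT => //; first exact: measurable_fun_ltr.
  by apply: measurable_fun_ifT => //; exact: measurable_fun_ltr.
apply/funext => t; rewrite /g /digit_tail /digit.
by case: ifP => // _; case: ifP.
Qed.

Lemma lebesgue_branch i (A : set R) : measurable A ->
  pushforward lebesgue_measure (branch i) A = ((3 : R)^-1%:E * lebesgue_measure A)%E.
Proof.
move=> mA.
have k0 : 0 <= (3 : R) by [].
pose br : measurableTypeR R -> measurableTypeR R := branch i.
have mbr : measurable_fun [set: measurableTypeR R] br.
  exact: measurable_branch.
pose m : {measure set (measurableTypeR R) -> \bar R} :=
  mscale (NngNum k0) (measure_function_pushforward__canonical__measure_function_Measure
    (@lebesgue_measure R) mbr).
(* Three times the pushforward has the right value on half-open intervals, and these determine
   Lebesgue measure. *)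
have -> : lebesgue_measure A = m A.
  apply: lebesgue_measure_unique mA => _ [[a b] _ <-] /=.
  rewrite /m /mscale /= /pushforward.
  have -> : branch i @^-1` `]a, b] = `](a + i%:R) / 3, (b + i%:R) / 3]%classic.
    apply/seteqP; split => t /=; rewrite !in_itv /= /branch;
      by move=> /andP[? ?]; apply/andP; split; lra.
  rewrite !lebesgue_measure_itv /= !lte_fin ltr_pM2r ?invr_gt0// ltrD2r.
  case: ifP => _; last by rewrite mule0.
  by rewrite -!EFinB -EFinM; congr EFin; field.
rewrite /m /mscale /= muleA -EFinM mulVf ?mul1e//.
Qed.

(** For uniform t the first digit is uniform and independent of the tail, which is again uniform. *)
Lemma integral_digit (f : 'I_3 -> R -> \bar R) :
  (forall i, measurable_fun [set: R] (f i)) -> (forall i t, 0 <= f i t)%E ->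
  (\int[lebesgue_measure]_(t in unit_itv) f (digit t) (digit_tail t) =
   (3 : R)^-1%:E * \sum_(i < 3) \int[lebesgue_measure]_(t in unit_itv) f i t)%E.
Proof.
move=> mf f0; rewrite [in LHS]unit_itv_branch.
rewrite ge0_integral_bigsetU//=; last 4 first.
- exact: measurable_branch_preimage.
- exact: index_enum_uniq.
- move=> i j _ _ [t [/digit_branch <- /digit_branch <-]] //.
- by apply: measurable_funS (measurable_digit mf).
have k0 : 0 <= (3 : R)^-1 by rewrite invr_ge0.
rewrite ge0_sume_distrr; last by move=> i _; exact: integral_ge0.
apply: eq_bigr => i _.
have mfD : measurable_fun unit_itv (f i) by exact: measurable_funS (mf i).
transitivity
    (\int[lebesgue_measure]_(t in branch i @^-1` unit_itv) (f i \o branch i) t)%E.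
  by apply: eq_integral => t; rewrite inE => /digit_branch ti; rewrite /digit_tail ti.
pose br : measurableTypeR R -> measurableTypeR R := branch i.
have mbr : measurable_fun [set: measurableTypeR R] br.
  exact: measurable_branch.
transitivity (\int[pushforward lebesgue_measure br]_(t in unit_itv) f i t)%E.
  rewrite (ge0_integral_pushforward mbr)//.
  exact: measurable_unit_itv.
pose la : {measure set (measurableTypeR R) -> \bar R} := @lebesgue_measure R.
transitivity (\int[mscale (NngNum k0) la]_(t in unit_itv) f i t)%E; last first.
  by rewrite ge0_integral_mscale//; exact: measurable_unit_itv.
pose m := measure_function_pushforward__canonical__measure_function_Measure la mbr.
apply: (@eq_measure_integral _ _ _ _ _ m) => A mA _.
exact: lebesgue_branch.
Qed.

End ternary_digits.

(** * Recovering a boundary point from its coordinates *)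

Section decode.
Variables (R : realType) (z : R * R).
Hypothesis z_gt0 : 0 < z.2.

(** Inverse stereographic projection; on the circle v = 0 only at the image of ∞. *)
Definition decode (u v : R) : extR R :=
  if v == 0 then None else Some (z.1 + z.2 * (u / v)).

Lemma circK x : decode (circ1 z x) (circ2 z x) = x.
Proof.
case: x => [t|]; last by rewrite circ2_None /decode eqxx.
have h0 := sqdist_gt0 t z_gt0.
rewrite circ1_some// circ2_some// /decode ifF; last first.
  by rewrite mulf_eq0 invr_eq0 (gt_eqF h0) mulf_eq0 (gt_eqF z_gt0) pnatr_eq0.
congr Some; field; rewrite (gt_eqF z_gt0) (gt_eqF h0)//.
Qed.

Lemma circ_sqrD x : circ1 z x ^+ 2 + circ2 z x ^+ 2 = 2 / z.2 * circ2 z x.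
Proof.
case: x => [t|]; last first.
  by rewrite circ1_None circ2_None mulr0 !expr0n addr0.
have h0 := sqdist_gt0 t z_gt0.
by rewrite circ1_some// circ2_some//; field; rewrite (gt_eqF z_gt0) (gt_eqF h0).
Qed.

Lemma decodeK u v : u ^+ 2 + v ^+ 2 = 2 / z.2 * v ->
  circ1 z (decode u v) = u /\ circ2 z (decode u v) = v.
Proof.
move=> uv; rewrite /decode; case: ifPn => [/eqP v0|v0].
  rewrite circ1_None circ2_None v0; split => //.
  by move: uv; rewrite v0 mulr0 expr0n addr0 => /eqP; rewrite sqrf_eq0 => /eqP.
have uvE : (z.1 + z.2 * (u / v) - z.1) ^+ 2 + z.2 ^+ 2 = 2 * z.2 / v.
  rewrite addrAC subrr add0r.
  rewrite (_ : _ + _ = z.2 ^+ 2 * (u ^+ 2 + v ^+ 2) / v ^+ 2); last by field.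
  by rewrite uv; field; rewrite (gt_eqF z_gt0) v0.
rewrite circ1_some// circ2_some// uvE; split; field; rewrite v0 (gt_eqF z_gt0)//.
Qed.

Lemma measurable_decode d (T : measurableType d) (f g : T -> R) :
  measurable_fun [set: T] f -> measurable_fun [set: T] g ->
  measurable_fun [set: T] (fun t => decode (f t) (g t)).
Proof.
move=> mf mg; apply: measurable_fun_ifT; first exact: measurable_fun_eqr.
  exact: measurable_cst.
apply: measurable_Some; apply: measurable_funD => //; apply: measurable_funM => //.
apply: measurable_funM => //.
exact: (measurableT_comp (@measurable_invr R) mg).
Qed.

End decode.

(** * Existence: the limit of backward random compositions *)

Section existence.
Variables (R : realType) (z : R * R) (tau : 'I_3 -> extR R -> extR R) (rho : R).
Hypothesis z_gt0 : 0 < z.2.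
Hypothesis mtau : forall i, measurable_fun [set: extR R] (tau i).
Hypothesis rho01 : 0 < rho < 1.
Hypothesis contract : forall x y,
  \sum_(i < 3) chord z (tau i x) (tau i y) <= 3 * rho * chord z x y.

Local Notation la := (@lebesgue_measure R).
Local Notation D := (@unit_itv R).

(** The first digit is applied last. In this order one more digit changes only the innermost point,
    which makes pointwise convergence possible. *)
Fixpoint walk (n : nat) (t : R) : extR R :=
  if n is m.+1 then tau (digit t) (walk m (digit_tail t)) else None.

Definition jump n t : R := chord z (walk n.+1 t) (walk n t).

Lemma measurable_walk n : measurable_fun [set: R] (walk n).
Proof.
elim: n => [|n IH] /=; first exact: measurable_cst.
apply: (measurable_digit (f := fun i t => tau i (walk n t))) => i.
exact: measurableT_comp.
Qed.

Lemma measurable_jump n : measurable_fun [set: R] (jump n).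
Proof. by apply: measurable_chord; exact: measurable_walk. Qed.

(** Splitting off the first digit averages the three images of the previous jump, so [contract]
    yields a factor rho at each step. *)
Lemma integral_jump n :
  (\int[la]_(t in D) (jump n t)%:E <= (6 / z.2 * rho ^+ n)%:E)%E.
Proof.
have mD := @measurable_unit_itv R.
have mE m : measurable_fun D (fun t => (jump m t)%:E).
  by apply/measurable_EFinP; exact: measurable_funS (measurable_jump m).
have j0 m t : D t -> (0 <= (jump m t)%:E)%E by move=> _; rewrite lee_fin chord_ge0.
elim: n => [|n IH].
  rewrite mulr1 -[leRHS]mule1 -(@lebesgue_unit_itv R) -integral_cst//.
  apply: ge0_le_integral; [exact: mD|exact: j0|exact: mE|exact: measurable_cst|].
  by move=> t _; rewrite lee_fin chord_bound.
pose f i t := (chord z (tau i (walk n.+1 t)) (tau i (walk n t)))%:E.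
have mf i : measurable_fun [set: R] (f i).
  apply/measurable_EFinP; apply: measurable_chord;
    apply: (measurableT_comp (mtau i)); exact: measurable_walk.
have f0 i t : (0 <= f i t)%E by rewrite lee_fin chord_ge0.
have -> : (\int[la]_(t in D) (jump n.+1 t)%:E =
    \int[la]_(t in D) f (digit t) (digit_tail t))%E by [].
rewrite integral_digit//.
rewrite -ge0_integral_sum//; last by move=> i; exact: measurable_funS (mf i).
rewrite -ge0_integralZl//; last 2 first.
- by apply: emeasurable_sum => i; exact: measurable_funS (mf i).
- by move=> t _; exact: sume_ge0.
apply: (@le_trans _ _ (\int[la]_(t in D) (rho%:E * (jump n t)%:E)))%E.
  apply: ge0_le_integral => //=.
  - by move=> t _; rewrite mule_ge0 ?lee_fin ?invr_ge0// sume_ge0.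
  - apply: measurable_funeM.
    by apply: emeasurable_sum => i; exact: measurable_funS (mf i).
  - by apply: measurable_funeM; exact: mE.
  move=> t _; rewrite sumEFin -!EFinM lee_fin ler_pdivrMl// mulrA.
  exact: contract.
have rho0 : (0 <= rho%:E)%E by rewrite lee_fin; case/andP: rho01 => /ltW.
rewrite ge0_integralZl; [|exact: mD|exact: mE|exact: j0|exact: rho0].
rewrite exprS mulrCA EFinM; exact: lee_wpmul2l.
Qed.

Definition total_jump t : \bar R := (\sum_(0 <= n <oo) (jump n t)%:E)%E.

Definition good : set R := [set t | (total_jump t < +oo)%E].

Lemma measurable_total_jump : measurable_fun [set: R] total_jump.
Proof.
rewrite /total_jump.
apply: (ge0_emeasurable_sum (h := fun n t => (jump n t)%:E) (P := xpredT)).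
  by move=> k t _ _; rewrite lee_fin chord_ge0.
by move=> k _; apply/measurable_EFinP; exact: measurable_jump.
Qed.

Lemma measurable_good : measurable good.
Proof.
rewrite (_ : good = total_jump @^-1` [set x | x < +oo]%E)//.
rewrite -[X in measurable X]setTI; apply: measurable_total_jump => //.
rewrite (_ : [set x | x < +oo]%E = ~` [set +oo]%E); last first.
  by apply/seteqP; split => x /=; rewrite ltey => /eqP.
exact: measurableC.
Qed.

(** The expected total jump is bounded by a convergent geometric series, so it is finite almost
    everywhere. *)
Lemma bad_null : la (D `\` good) = 0%E.
Proof.
have mD := @measurable_unit_itv R.
have intE : (\int[la]_(t in D) total_jump t < +oo)%E.
  rewrite /total_jump integral_nneseries//; last 2 first.
  - move=> n; apply/measurable_EFinP; exact: measurable_funS (measurable_jump n).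
  - by move=> n t _; rewrite lee_fin chord_ge0.
  have [r0 r1] := andP rho01.
  have M0 : 0 <= 6 / z.2 by rewrite divr_ge0// ltW.
  apply: (@le_lt_trans _ _ (6 / z.2 / (1 - rho))%:E); last by rewrite ltry.
  apply: lime_le.
    by apply: is_cvg_nneseries => n _ _; apply: integral_ge0 => t _; rewrite lee_fin chord_ge0.
  apply: nearW => n.
  apply: (@le_trans _ _ (\sum_(0 <= i < n) (6 / z.2 * rho ^+ i)%:E)%E).
    by apply: lee_sum => i _; exact: integral_jump.
  rewrite sumEFin lee_fin; apply: geometric_le_lim => //.
  by rewrite gtr0_norm.
have inte : la.-integrable D total_jump.
  apply/integrableP; split.
    exact: measurable_funS measurable_total_jump.
  suff -> : (\int[la]_(t in D) `|total_jump t| = \int[la]_(t in D) total_jump t)%E by [].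
  apply: eq_integral => t _; rewrite gee0_abs//.
  by apply: nneseries_ge0 => n _ _; rewrite lee_fin chord_ge0.
apply: measure_negligible; first by apply: measurableD => //; exact: measurable_good.
have ae : la.-negligible (~` [set t | D t -> total_jump t \is a fin_num]).
  by apply: integrable_ae inte; exact: mD.
apply: (negligibleS _ ae) => t [Dt /= ng] /(_ Dt).
by rewrite fin_numE => /andP[_ /eqP ty]; apply: ng; rewrite /good /= ltey; apply/eqP.
Qed.

Lemma good_cvg (f : extR R -> R) t :
  (forall x y, `|f x - f y| <= chord z x y) -> good t ->
  cvgn (fun n => f (walk n t)).
Proof.
move=> fl gt.
pose u n := f (walk n t).
have : cvgn (series (telescope u)).
  apply: normed_cvg; apply: nondecreasing_is_cvgn.
    by apply: nondecreasing_series => n _ _ /=.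
  exists (fine (total_jump t)) => _ [n _ <-].
  have tj0 : (0 <= total_jump t)%E.
    by apply: nneseries_ge0 => k _ _; rewrite lee_fin chord_ge0.
  rewrite -lee_fin fineK ?ge0_fin_numE//.
  apply: (@le_trans _ _ (\sum_(0 <= k < n) (jump k t)%:E)%E).
    rewrite sumEFin lee_fin; apply: ler_sum => k _ /=.
    exact: fl.
  by apply: nneseries_lim_ge => k _ _; rewrite lee_fin chord_ge0.
move=> /cvg_ex[l cl]; apply/cvg_ex; exists (u 0%N + l).
rewrite (_ : (fun n => _) = (fun n => u 0%N + series (telescope u) n)); last first.
  by apply/funext => n; rewrite -eq_sum_telescope.
by apply: cvgD => //; exact: cvg_cst.
Qed.

(** The default 0 off [good] makes the sequence converge at every t, so that the limit is
    measurable. *)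
Definition limit_coord (c : extR R -> R) (t : R) : R :=
  limn (fun n => if t \in good then c (walk n t) else 0).

Definition endpoint (t : R) : extR R :=
  decode z (limit_coord (circ1 z) t) (limit_coord (circ2 z) t).

Lemma measurable_limit_coord (c : extR R -> R) :
  measurable_fun [set: extR R] c ->
  (forall x y, `|c x - c y| <= chord z x y) ->
  measurable_fun [set: R] (limit_coord c).
Proof.
move=> mc lc.
apply: (measurable_fun_cvg
  (h := fun n t => if t \in good then c (walk n t) else 0)).
  move=> n; apply: measurable_fun_ifT => //.
    apply: (measurable_fun_bool true); rewrite setTI.
    rewrite (_ : _ @^-1` _ = good); first exact: measurable_good.
    by apply/seteqP; split => t /=; [move/set_mem|move/mem_set].
  exact: measurableT_comp (measurable_walk n).
move=> t _; rewrite /limit_coord; case: (boolP (t \in good)) => [|_]; last exact: is_cvg_cst.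
by rewrite inE => gt; exact: good_cvg.
Qed.

Lemma measurable_endpoint : measurable_fun [set: R] endpoint.
Proof.
apply: measurable_decode; apply: measurable_limit_coord.
- exact: measurable_circ1.
- exact: circ1_chord.
- exact: measurable_circ2.
- exact: circ2_chord.
Qed.

Lemma walk_cvg t : good t ->
  circ1 z (walk n t) @[n --> \oo] --> circ1 z (endpoint t) /\
  circ2 z (walk n t) @[n --> \oo] --> circ2 z (endpoint t).
Proof.
move=> gt.
have c1 : circ1 z (walk n t) @[n --> \oo] --> limit_coord (circ1 z) t.
  by rewrite /limit_coord mem_set//; apply: good_cvg => //; exact: circ1_chord.
have c2 : circ2 z (walk n t) @[n --> \oo] --> limit_coord (circ2 z) t.
  by rewrite /limit_coord mem_set//; apply: good_cvg => //; exact: circ2_chord.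
(* The circle equation passes to the limit, so the limiting coordinates are those of a boundary
   point. *)
suff /(decodeK z_gt0) [-> ->] : limit_coord (circ1 z) t ^+ 2 +
    limit_coord (circ2 z) t ^+ 2 = 2 / z.2 * limit_coord (circ2 z) t by [].
have cl : (fun n => circ1 z (walk n t) ^+ 2 + circ2 z (walk n t) ^+ 2) @ \oo -->
    limit_coord (circ1 z) t ^+ 2 + limit_coord (circ2 z) t ^+ 2.
  by apply: cvgD; apply: cvgM.
have cr : (fun n => circ1 z (walk n t) ^+ 2 + circ2 z (walk n t) ^+ 2) @ \oo -->
    2 / z.2 * limit_coord (circ2 z) t.
  rewrite (_ : (fun n => _) = (fun n => 2 / z.2 * circ2 z (walk n t))); last first.
    by apply/funext => n; rewrite circ_sqrD.
  by apply: cvgM => //; exact: cvg_cst.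
exact: (cvg_unique _ cl cr).
Qed.

Lemma tau_lipschitz i x y : chord z (tau i x) (tau i y) <= 3 * rho * chord z x y.
Proof.
apply: le_trans (contract x y); rewrite (bigD1 i)//= lerDl.
by apply: sumr_ge0 => j _; exact: chord_ge0.
Qed.

Lemma endpoint_shift t : good t -> good (digit_tail t) ->
  endpoint t = tau (digit t) (endpoint (digit_tail t)).
Proof.
move=> gt gst.
have [c1 c2] := walk_cvg gt; have [s1 s2] := walk_cvg gst.
have ch0 : chord z (walk n (digit_tail t)) (endpoint (digit_tail t)) @[n --> \oo] --> (0 : R).
  pose q n := `|circ1 z (walk n (digit_tail t)) - circ1 z (endpoint (digit_tail t))| +
    `|circ2 z (walk n (digit_tail t)) - circ2 z (endpoint (digit_tail t))|.
  have q0 : q @ \oo --> (0 : R).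
    rewrite (_ : (0 : R) = `|circ1 z (endpoint (digit_tail t)) - circ1 z (endpoint (digit_tail t))| +
      `|circ2 z (endpoint (digit_tail t)) - circ2 z (endpoint (digit_tail t))|).
      by apply: cvgD; apply: cvg_norm; apply: cvgB => //; exact: cvg_cst.
    by rewrite !subrr normr0 addr0.
  apply: (squeeze_cvgr _ (cvg_cst (0 : R)) q0); apply: nearW => n.
  rewrite chord_ge0 /= -(ler_pXn2r (ltn0Sn 1)) ?nnegrE ?chord_ge0 ?addr_ge0//.
  rewrite chord_sqrE /q [leRHS]sqrrD !real_normK ?num_real//.
  by rewrite addrAC lerDl mulrn_wge0// mulr_ge0.
have lim (f : extR R -> R) : (forall x y, `|f x - f y| <= chord z x y) ->
    f (walk n t) @[n --> \oo] --> f (tau (digit t) (endpoint (digit_tail t))).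
  (* Step n + 1 of the walk at t is the image under [tau (digit t)] of step n at the tail;
     continuity of that map gives the limit. *)
  move=> fl; rewrite -cvg_shiftS; apply/subr_cvg0.
  apply: norm_cvg0.
  apply: (squeeze_cvgr _ (cvg_cst (0 : R))
    (_ : 3 * rho * chord z (walk n (digit_tail t)) (endpoint (digit_tail t)) @[n --> \oo] --> 0)).
    apply: nearW => n; rewrite normr_ge0 /=.
    exact: le_trans (fl _ _) (tau_lipschitz _ _ _).
  rewrite -[X in _ --> X](mulr0 (3 * rho)); apply: cvgM => //; exact: cvg_cst.
have e1 := cvg_unique _ c1 (lim _ (@circ1_chord R z)).
have e2 := cvg_unique _ c2 (lim _ (@circ2_chord R z)).
by rewrite -[LHS](circK z_gt0) e1 ?e2 ?circK.
Qed.

(** Take the law of [endpoint] under uniform t: [endpoint_shift] holds almost everywhere, and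
    [integral_digit] turns it into stationarity. *)
Lemma stationary_exists : exists mu : probability (extR R) R, stationary tau mu.
Proof.
have mD := @measurable_unit_itv R.
have mY := measurable_endpoint.
pose m0 : {measure set (measurableTypeR R) -> \bar R} := mrestr la mD.
pose Y : measurableTypeR R -> extR R := endpoint.
have mY' : measurable_fun [set: measurableTypeR R] Y by exact: mY.
pose m : {measure set (extR R) -> \bar R} :=
  measure_function_pushforward__canonical__measure_function_Measure m0 mY'.
have mT : m setT = 1%E.
  rewrite /m /= /pushforward preimage_setT /m0 /= /mrestr setTI.
  exact: lebesgue_unit_itv.
pose mu : probability (extR R) R := HB.pack (Measure.sort m)
  (Measure_isProbability.Build _ _ _ (Measure.sort m) mT).
exists mu => A mA.
have muE B : measurable B -> mu B = (\int[la]_(t in D) (\1_B (endpoint t))%:E)%E.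
  move=> mB; transitivity (\int[la]_(t in D) (\1_(endpoint @^-1` B) t)%:E)%E.
    rewrite integral_indic//.
    by rewrite -[X in measurable X]setTI; exact: mY.
  by apply: eq_integral => t _; rewrite !indicE.
have mIA : measurable_fun [set: extR R] (\1_A : extR R -> R) by exact: measurable_indic.
have mind i : measurable_fun [set: R] (fun t => (\1_A (tau i (endpoint t)))%:E : \bar R).
  apply/measurable_EFinP; apply: (measurableT_comp mIA).
  exact: measurableT_comp.
rewrite muE//.
transitivity (\int[la]_(t in D) (\1_A (tau (digit t) (endpoint (digit_tail t))))%:E)%E; last first.
  rewrite (integral_digit (f := fun i t => (\1_A (tau i (endpoint t)))%:E))//.
  congr (_ * _)%E; apply: eq_bigr => i _; rewrite /pushforward muE//.
  by rewrite -[X in measurable X]setTI; exact: mtau.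
have mng : measurable [set t | ~ good (digit_tail t)].
  rewrite (_ : [set t | _] = @digit_tail R @^-1` (~` good))//.
  rewrite -[X in measurable X]setTI.
  apply: (measurable_digit (f := fun _ t => t)) => //.
  by apply: measurableC; exact: measurable_good.
(* The tail is again uniform, so it too is bad with probability 0. *)
have bad_shift : la (D `&` [set t | ~ good (digit_tail t)]) = 0%E.
  rewrite setIC -integral_indic//.
  transitivity (\int[la]_(t in D) (\1_(~` good) (digit_tail t))%:E)%E.
    by apply: eq_integral => t _; rewrite !indicE.
  rewrite (integral_digit (f := fun _ t => (\1_(~` good) t)%:E))//.
  - rewrite big1 ?mule0// => i _; rewrite integral_indic//.
      by rewrite setIC -setDE; exact: bad_null.
    by apply: measurableC; exact: measurable_good.
  - move=> _; apply/measurable_EFinP; apply: measurable_indic.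
    by apply: measurableC; exact: measurable_good.
apply: ge0_ae_eq_integral => //.
- apply/measurable_EFinP; apply: measurableT_comp mIA _.
  exact: measurable_funS mY.
- apply: measurable_funS (measurable_digit mind) => //.
exists ((D `\` good) `|` (D `&` [set t | ~ good (digit_tail t)])); split.
- by apply: measurableU; [apply: measurableD => //; exact: measurable_good|exact: measurableI].
- apply/eqP; rewrite -measure_le0.
  apply: le_trans (measureU2 _ _ _) _.
  + by apply: measurableD => //; exact: measurable_good.
  + exact: measurableI.
  + have eq_le0 (x : \bar R) : x = 0%E -> (x <= 0)%E by move=> ->.
    rewrite -[leRHS](adde0 0%E).
    by apply: leeD; apply: eq_le0; [exact: bad_null|exact: bad_shift].
- move=> t /= /not_implyP [Dt ne].
  have [gt|gt] := pselect (good t); last by left.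
  have [gst|gst] := pselect (good (digit_tail t)); last by right.
  by exfalso; apply: ne; rewrite endpoint_shift.
Qed.

End existence.

Theorem mainTheorem4 (R : realType) (L : 'I_3 -> hline R) (z0 : R * R) :
  (forall i, wf_hline (L i)) ->
  Hplane z0 ->
  (forall i j : 'I_3, i != j -> pair_condition (L i) (L j) z0) ->
  exists mu : probability (extR R) R,
    (forall A : set (extR R), measurable A ->
       (mu A = ((3 : R)^-1)%:E *
         \sum_(i < 3) pushforward mu (oneway (L i) z0) A)%E) /\
    (forall nu : probability (extR R) R,
       (forall A : set (extR R), measurable A ->
          (nu A = ((3 : R)^-1)%:E *
            \sum_(i < 3) pushforward nu (oneway (L i) z0) A)%E) ->
       forall A : set (extR R), measurable A -> nu A = mu A).
Proof.
move=> wfL z_gt0 pc.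
have [rho /andP[rho0 rho1] contract] := oneway_average_contract z_gt0 wfL pc.
have mtau i := @measurable_oneway R (L i) z0.
have rho01 : 0 < rho < 1 by rewrite rho0.
have [mu mu_st] := stationary_exists z_gt0 mtau rho01 contract.
exists mu; split=> // nu nu_st.
by apply: (stationary_unique z_gt0 mtau _ contract) => //; rewrite (ltW rho0).
Qed.
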